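(* If there exists a sparse set $B$ such that $\{A : A\le_T^{O}B\}\neq\{A : A\le_T^{p}B\}$, then $\mathrm{P}\neq\mathrm{NP}$.
   Context: A set $S\subseteq\{0,1\}^*$ is sparse if there is a polynomial $r$ with $|S\cap\Sigma^{\le n}|\le r(n)$ for all $n$. $\le_T^p$ is polynomial-time Turing reducibility. An NPTM is a nondeterministic oracle Turing machine $N$ each of whose computation paths ends in one of three outcomes $\mathbf{acc}$, $\mathbf{rej}$, $\mathbf{?}$, such that there is a polynomial $p$ with: for every oracle $D$ and every input $x$, every computation path of $N^D(x)$ has length at most $p(|x|)$. For an oracle $D$ and input $x$, let $out_{N^D}(x)$ be the set of outcomes occurring on some path of $N^D(x)$; $L(N^D)=\{x:\mathbf{acc}\in out_{N^D}(x)\}$. $N^D(x)$ is underproductive if $\{\mathbf{acc},\mathbf{rej}\}\not\subseteq out_{N^D}(x)$, and overproductive if $out_{N^D}(x)\neq\{\mathbf{?}\}$; $N^D$ is underproductive (overproductive) if $N^D(x)$ is so for every $x$. $N$ is robustly overproductive if $N^D$ is overproductive for every oracle $D$. $A\le_T^{O}B$ if there is an NPTM $N$ that is robustly overproductive, with $N^B$ underproductive, and $A=L(N^B)$. *)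

(* Defs.v *)
From HB Require Import structures.
From mathcomp Require Import all_boot all_algebra.
From mathcomp Require Import boolp classical_sets.

Set Implicit Arguments.
Unset Strict Implicit.
Unset Printing Implicit Defensive.

Local Open Scope nat_scope.
Local Open Scope classical_set_scope.

Notation word := (seq bool).
Notation language := (set (seq bool)).

(* A tape is infinite in both directions.  In (l, r) the head scans the first
   letter of r, the rest of r lies to its right, and l lists the cells to its
   left starting from the nearest; every cell not listed is blank. *)

Inductive move := Left | Stay | Right.

Definition bool_of_move (m : move) : option bool :=
  match m with Left => Some false | Stay => None | Right => Some true end.
Definition move_of_bool (b : option bool) : move :=
  match b with Some false => Left | None => Stay | Some true => Right end.
Lemma bool_of_moveK : cancel bool_of_move move_of_bool.
Proof. by case. Qed.
HB.instance Definition _ := Countable.copy move (can_type bool_of_moveK).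
HB.instance Definition _ : isFinite move := CanIsFinite bool_of_moveK.

(* None is the blank; G consists of the letters other than the two bits. *)
Definition symbol (G : finType) : finType := option (bool + G)%type.

Definition tape (G : finType) : Type := (seq (symbol G) * seq (symbol G))%type.

Section Tape.
Variable G : finType.
Implicit Types (t : tape G) (s : symbol G).

Definition blank_tape : tape G := ([::], [::]).

Definition input_tape (x : word) : tape G :=
  ([::], [seq (Some (inl b) : symbol G) | b <- x]).

Definition read t : symbol G := head None t.2.

Definition write s t : tape G := (t.1, s :: behead t.2).

Definition shift (m : move) t : tape G :=
  match m with
  | Left => (behead t.1, head None t.1 :: t.2)
  | Stay => t
  | Right => (read t :: t.1, behead t.2)
  end.

End Tape.

(* In addition to its read-write tapes, a machine has a write-only oracle tape,
   which is erased by each query: an action goes to a new state, writes at most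
   one further bit on the oracle tape, and on each read-write tape writes a
   symbol and then moves the head. *)
Definition action (k : nat) (Q G : finType) : finType :=
  (Q * option bool * {ffun 'I_k.+1 -> symbol G * move})%type.

Inductive mode (O Q : Type) :=
  | Halt of O
  | Query of Q & Q (* successor states for the answers yes and no *)
  | Work.
Arguments Halt {O Q}.
Arguments Query {O Q}.
Arguments Work {O Q}.

(* Nondeterministic multitape oracle machines whose paths end with an outcome
   in O.  Tape 0 holds the input.  Only the values of delta at working states
   matter; they are nonempty, so a path can only end in a halting state. *)
Record machine (O : Type) := Machine {
  ntapes : nat; (* number of read-write tapes other than the input tape *)
  state : finType;
  letter : finType;
  start : state;
  mode_of : state -> mode O state;
  delta : state -> {ffun 'I_ntapes.+1 -> symbol letter} ->
          {set action ntapes state letter};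
  delta_gt0 : forall q s, 0 < #|delta q s|
}.

Section Runs.
Variables (O : Type) (M : machine O).

Definition tapes : Type := {ffun 'I_(ntapes M).+1 -> tape (letter M)}.

(* state, read-write tapes, contents of the oracle tape *)
Definition config : Type := (state M * tapes * word)%type.

Definition init (x : word) : config :=
  (start M,
   [ffun i => if i == ord0 then input_tape (letter M) x
              else blank_tape (letter M)],
   [::]).

Definition reads (t : tapes) : {ffun 'I_(ntapes M).+1 -> symbol (letter M)} :=
  [ffun i => read (t i)].

Definition update (f : {ffun 'I_(ntapes M).+1 -> symbol (letter M) * move})
    (t : tapes) : tapes :=
  [ffun i => shift (f i).2 (write (f i).1 (t i))].

Inductive step (D : language) : config -> config -> Prop :=
  | step_work q t w q' (b : option bool)
      (f : {ffun 'I_(ntapes M).+1 -> symbol (letter M) * move}) :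
      mode_of q = Work -> (q', b, f) \in delta q (reads t) ->
      step D (q, t, w) (q', update f t, w ++ oapp (fun a => [:: a]) [::] b)
  | step_yes q t w qy qn :
      mode_of q = Query qy qn -> D w -> step D (q, t, w) (qy, t, [::])
  | step_no q t w qy qn :
      mode_of q = Query qy qn -> ~ D w -> step D (q, t, w) (qn, t, [::]).

Inductive run (D : language) (c : config) : nat -> config -> Prop :=
  | run0 : run D c 0 c
  | runS n c' c'' : run D c n c' -> step D c' c'' -> run D c n.+1 c''.

Definition out (D : language) (x : word) : set O :=
  [set o | exists n c, run D (init x) n c /\ mode_of c.1.1 = Halt o].

Definition polytime : Prop :=
  exists p : {poly nat}, forall D x n c,
    run D (init x) n c -> n <= p.[size x]%R.

Definition deterministic : Prop := forall (q : state M) s, #|delta q s| = 1.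

Definition oracle_free : Prop := forall q qy qn : state M,
  mode_of q <> Query qy qn.

End Runs.

(* Ordinary acceptors have outcomes in bool, where true means acceptance. *)
Definition accepted (M : machine bool) (D : language) : language :=
  [set x | out M D x true].

Definition classP : set language :=
  [set A | exists M : machine bool,
    [/\ polytime M, deterministic M, oracle_free M & A = accepted M set0]].

Definition classNP : set language :=
  [set A | exists M : machine bool,
    [/\ polytime M, oracle_free M & A = accepted M set0]].

Definition reducesT (A B : language) : Prop :=
  exists M : machine bool,
    [/\ polytime M, deterministic M & A = accepted M B].

Inductive outcome := Acc | Rej | Unknown.

Definition lang (N : machine outcome) (D : language) : language :=
  [set x | out N D x Acc].

Definition underproductive (N : machine outcome) (D : language) : Prop :=
  forall x, ~ ([set Acc; Rej] `<=` out N D x).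

Definition overproductive (N : machine outcome) (D : language) : Prop :=
  forall x, out N D x <> [set Unknown].

Definition robustly_overproductive (N : machine outcome) : Prop :=
  forall D, overproductive N D.

Definition reducesO (A B : language) : Prop :=
  exists N : machine outcome,
    [/\ polytime N, robustly_overproductive N, underproductive N B
      & A = lang N B].

(* n.-bseq bool is the type of words of length at most n. *)
Definition sparse (S : language) : Prop :=
  exists r : {poly nat}, forall n,
    #|[pred w : n.-bseq bool | `[< S w >]]| <= r.[n]%R.

(* Main.v *)
Require Import Defs.
From mathcomp Require Import all_boot all_algebra.
From mathcomp Require Import boolp classical_sets.
From HB Require Import structures.
From mathcomp Require Import perm zify.

(** Let P = NP and let B be sparse, and let N reduce A to B as in the hypothesis.
    On input x a deterministic machine keeps a list Y of words of B.  Since N is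
    overproductive with the finite oracle Y, some path of N with that oracle ends
    in acc or rej; the events of such a path (bits written on the oracle tape,
    answers to queries, outcome) are found one after the other by asking an NP
    language, here decided in polynomial time, whether a log can be extended.
    Each query is put to B as soon as it is found.  If Y and B agree along the
    path, then it is also a path with oracle B, whose outcome is right because N
    is underproductive with B.  Otherwise the first word on which they differ is a
    new word of B; it joins Y and the search starts again.  Sparseness bounds the
    number of restarts.  For other oracles nothing bounds it, so a clock stops the
    machine. *)

Set Implicit Arguments.
Unset Strict Implicit.
Unset Printing Implicit Defensive.

Local Open Scope nat_scope.
Local Open Scope classical_set_scope.

(** * Machines on streams, with tapes indexed by a finite type *)

(** All that the driver remembers between two calls is one word, the transcript of every event so
    far followed by x. Both the current log and Y are read off from it, Y consisting of the queries
    that led to a restart. So the driver updates its data only by putting bits in front of this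
    word, which is also the word given to the decision procedure. The NP language does not mention
    B: its verifier simulates N and answers the queries from Y. Two obstacles shape the machines.
    The decision procedure is called many times on the same tapes and must find them blank each
    time; hence the steps of a call are recorded and undone. The clock must count up to a given
    polynomial; k tapes of the length of the input serve as k digits, with k depending on the
    polynomial. In the converse inclusion a deterministic reduction becomes an O-reduction when its
    outcomes are renamed [Acc] and [Rej]: every path is productive, and only one outcome occurs. *)

Definition stape (S : Type) : Type := ((nat -> S) * (nat -> S))%type.

Section Streams.
Variable S : Type.
Implicit Types (f : nat -> S) (t : stape S).

Definition scons (a : S) f (n : nat) : S := if n is m.+1 then f m else a.
Definition stail f (n : nat) : S := f n.+1.
Definition scat (s : seq S) f : nat -> S := foldr scons f s.

Definition sread t : S := t.2 0.

Definition act (a : S * move) t : stape S :=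
  match a.2 with
  | Left => (stail t.1, scons (t.1 0) (scons a.1 (stail t.2)))
  | Stay => (t.1, scons a.1 (stail t.2))
  | Right => (scons a.1 t.1, stail t.2)
  end.

Lemma scons_eta f : scons (f 0) (stail f) = f.
Proof. by apply/funext => -[]. Qed.

Lemma act_stay t : act (sread t, Stay) t = t.
Proof. by case: t => l r; rewrite /act /= scons_eta. Qed.

(** The head has moved from the cut between [l] and [r] onto the nearest cell of [l]. *)
Definition left_of (l r : nat -> S) : stape S := (stail l, scons (l 0) r).

Lemma act_left_keep t : act (sread t, Left) t = left_of t.1 t.2.
Proof. by case: t => l r; rewrite /act /= scons_eta. Qed.

Definition opposite (m : move) : move :=
  match m with Left => Right | Stay => Stay | Right => Left end.

(** An action writes before it moves, so undoing it takes two actions: move back without changing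
    the scanned symbol, then restore the old symbol. On streams the result is [t] itself; on lists
    it could differ by trailing blanks. *)
Lemma act_undo a t :
  act (sread t, Stay) (act (sread (act a t), opposite a.2) (act a t)) = t.
Proof.
by case: a t => s [] [l r]; rewrite /act /sread /=; congr pair;
  apply/funext; do 2?case.
Qed.

End Streams.

Arguments sread : simpl never.

Definition smap (S S' : Type) (e : S -> S') (t : stape S) : stape S' :=
  (e \o t.1, e \o t.2).

Lemma act_smap (S S' : Type) (e : S -> S') (s : S) (m : move) (t : stape S) :
  act (e s, m) (smap e t) = smap e (act (s, m) t).
Proof.
by case: m; case: t => l r; rewrite /act /smap /=; congr pair;
  apply/funext; do 2?case.
Qed.

Section Blank.
Variable G : finType.

Definition blanks (n : nat) : symbol G := None.

Definition stape_of (t : tape G) : stape (symbol G) := (nth None t.1, nth None t.2).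

Lemma stape_of_act s m (t : tape G) :
  stape_of (shift m (write s t)) = act (s, m) (stape_of t).
Proof.
case: t => l r; case: m; rewrite /stape_of /act /shift /write /read /=;
  congr pair; apply/funext; do 2?case => //=;
  by case: l => [|? ?] //=; case: r => [|? ?] //=; case.
Qed.

Lemma sread_of (t : tape G) : sread (stape_of t) = read t.
Proof. by case: t => l [|a r]. Qed.

Lemma scons_blank : scons None blanks = blanks.
Proof. by apply/funext => -[]. Qed.

Lemma nth_scat (s : seq (symbol G)) : nth None s = scat s blanks.
Proof.
by apply/funext => i; elim: s i => [|a s IH] [|i] //=; rewrite IH.
Qed.

End Blank.

(** A machine built on top of another one gets its additional tapes as additional constructors of
    the index type. *)
Record gmachine (O : Type) := GMachine {
  gtape : finType;
  ginput : gtape;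
  gstate : finType;
  gletter : finType;
  gstart : gstate;
  gmode : gstate -> mode O gstate;
  gdelta : gstate -> (gtape -> symbol gletter) ->
    set (gstate * option bool * (gtape -> symbol gletter * move));
  gdelta_neq0 : forall q s, gdelta q s !=set0
}.

Definition wbit (b : option bool) : word := oapp (fun a => [:: a]) [::] b.

Section GRuns.
Variables (O : Type) (g : gmachine O) (D : language).

Definition gtapes : Type := gtape g -> stape (symbol (gletter g)).
Definition gconfig : Type := (gstate g * gtapes * word)%type.
Implicit Types (c d : gconfig).

Definition sbits (x : word) : nat -> symbol (gletter g) :=
  scat [seq Some (inl b) | b <- x] (@blanks _).

Definition ginit (x : word) : gconfig :=
  (gstart g,
   fun i => if i == ginput g then (@blanks _, sbits x)
            else (@blanks _, @blanks _), [::]).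

Definition gacts (f : gtape g -> symbol (gletter g) * move) (t : gtapes) : gtapes :=
  fun i => act (f i) (t i).

Definition gstep c d : Prop :=
  let: (q, t, w) := c in
  match gmode q with
  | Halt _ => False
  | Query qy qn => d = (if `[< D w >] then qy else qn, t, [::])
  | Work => exists2 a, gdelta q (fun i => sread (t i)) a &
      d = (a.1.1, gacts a.2 t, w ++ wbit a.1.2)
  end.

(** Every path from [c] has at most [m] steps. The recursion provides the induction on the remaining
    time that the simulations follow. *)
Fixpoint gbound (m : nat) c : Prop :=
  forall d, gstep c d -> if m is m'.+1 then gbound m' d else False.

Inductive gout : gconfig -> O -> Prop :=
| gout_halt c o : gmode c.1.1 = Halt o -> gout c o
| gout_step c d o : gstep c d -> gout d o -> gout c o.

Lemma gboundS m c : gbound m c -> gbound m.+1 c.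
Proof.
elim: m c => [|m IH] c /= h d /h //; exact: IH.
Qed.

Lemma gbound_leq m m' c : m <= m' -> gbound m c -> gbound m' c.
Proof.
move=> /subnK <-; elim: (m' - m) => [//|k IH] /IH; exact: gboundS.
Qed.

Lemma gstep_halt c d o : gmode c.1.1 = Halt o -> ~ gstep c d.
Proof. by case: c => [[q t] w] /= ->. Qed.

Lemma gbound_halt m c o : gmode c.1.1 = Halt o -> gbound m c.
Proof. by move=> h; case: m => [|m] d /(gstep_halt h). Qed.

Lemma gout_haltE c o o' : gmode c.1.1 = Halt o -> gout c o' <-> o' = o.
Proof.
move=> h; split=> [r|->]; last exact: gout_halt.
case: c o' / r h => [c o' h|c d o' s _] h'; last by case: (gstep_halt h' s).
by move: h; rewrite h' => -[].
Qed.

Lemma gout_stepE c o : (forall o', gmode c.1.1 <> Halt o') ->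
  gout c o <-> exists2 d, gstep c d & gout d o.
Proof.
move=> h; split=> [r|[d s r]]; last exact: gout_step s r.
by case: c o / r h => [c o e /(_ o)|c d o s r _] //; exists d.
Qed.

(** A forced run: each configuration before the last has exactly one successor. This lets time
    bounds and outcomes travel back from the end of the run to its start. As [go0] leaves the number
    free, it is an upper bound on the length. *)
Inductive go : nat -> gconfig -> gconfig -> Prop :=
| go0 n c : go n c c
| goS n c d e : (forall c', gstep c c' <-> c' = d) -> go n d e -> go n.+1 c e.

Lemma go_trans n m c d e : go n c d -> go m d e -> go (n + m) c e.
Proof.
move=> r; elim: n c d / r => [n c|n c d d' h _ IH] r.
  elim: m c e / r => [m c|m c d f h _ IH]; first exact: go0.
  by rewrite addnS; apply: goS h _.
by rewrite addSn; apply: goS h _; apply: IH.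
Qed.

Lemma go_leq n m c d : n <= m -> go n c d -> go m c d.
Proof. by move=> /subnKC <- r; apply: go_trans r (go0 _ _). Qed.

Lemma go_bound n m c d : go n c d -> gbound m d -> gbound (n + m) c.
Proof.
move=> r; elim: n c d / r => [n c|n c d e h _ IH] b.
  by apply: gbound_leq b; rewrite leq_addl.
by move=> c' /h ->; apply: IH.
Qed.

Lemma go_out n c d o : go n c d -> gout c o <-> gout d o.
Proof.
move=> r; elim: n c d / r => [//|n c d e h _ <-]; split; last first.
  by apply: gout_step; apply/h.
have hd : gstep c d by apply/h.
move=> r; case: c o / r hd h => [c o e' hd|c d' o s r _ h].
  by case: (gstep_halt e' hd).
by move: s; rewrite h => <-.
Qed.

Lemma go_work q t w q' b f : gmode q = Work ->
  gdelta q (fun i => sread (t i)) = [set (q', b, f)] ->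
  go 1 (q, t, w) (q', gacts f t, w ++ wbit b).
Proof.
move=> hq hd; apply: goS (go0 _ _) => c'.
rewrite /gstep hq; split=> [[a]|->]; first by rewrite hd => ->.
by exists (q', b, f) => //; rewrite hd.
Qed.

Lemma go_query q t w qy qn : gmode q = Query qy qn ->
  go 1 (q, t, w) (if `[< D w >] then qy else qn, t, [::]).
Proof. by move=> hq; apply: goS (go0 _ _) => c'; rewrite /gstep hq. Qed.

End GRuns.

(** * Bisimulations transfer time bounds and outcomes *)

Section MachineRuns.
Variables (O : Type) (M : machine O) (D : language).

Lemma run_step (c c' : config M) n c'' :
  step D c c' -> run D c' n c'' -> run D c n.+1 c''.
Proof.
move=> s r; elim: n c'' / r => [|n d e _ IH s']; last exact: runS IH s'.
exact: runS (run0 _ _) s.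
Qed.

Lemma run_inv (c : config M) n c'' :
  run D c n.+1 c'' -> exists2 c', step D c c' & run D c' n c''.
Proof.
elim: n c'' => [|n IH] c'' r; inversion_clear r as [|? d ? r' s].
  by inversion r'; subst; exists c''; [|exact: run0].
by have [e s' r''] := IH _ r'; exists e => //; apply: runS r'' s.
Qed.

Variables (g : gmachine O) (F : config M -> gconfig g).
Hypothesis F_step : forall c c', step D c c' -> gstep D (F c) (F c').
Hypothesis step_F : forall c d, gstep D (F c) d -> exists2 c', step D c c' & F c' = d.
Hypothesis F_halt : forall c o, mode_of c.1.1 = Halt o <-> gmode (F c).1.1 = Halt o.

Lemma run_gbound m c :
  (forall n c', run D c n c' -> n <= m) <-> gbound D m (F c).
Proof.
split.
  elim: m c => [|m IH] c h d /step_F [c' s e].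
    by have := h _ _ (runS (run0 D c) s).
  by rewrite -e; apply: IH => n c'' r; rewrite -ltnS; apply: h (run_step s r).
elim: m c => [|m IH] c h [//|n] c' /run_inv [d s r].
  by have := h _ (F_step s).
by rewrite ltnS; apply: IH r; apply: (h _ (F_step s)).
Qed.

Lemma run_gout c o :
  (exists n c', run D c n c' /\ mode_of c'.1.1 = Halt o) <-> gout D (F c) o.
Proof.
split=> [[n [c' [r h]]]|r].
  elim: n c r => [|n IH] c r.
    inversion r; subst; by apply: gout_halt; apply/F_halt.
  have [d s r'] := run_inv r.
  exact: gout_step (F_step s) (IH _ r').
move eFc: (F c) r => d r.
elim: d o / r c eFc => [d o h c e|d d' o s _ IH c e].
  by exists 0, c; split; [exact: run0|apply/F_halt; rewrite e].
move: s; rewrite -e => /step_F [c' s e'].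
have [n [c'' [r h]]] := IH _ e'.
by exists n.+1, c''; split=> //; apply: run_step s r.
Qed.

End MachineRuns.

(** * From machines to machines on streams *)

Section OfMachine.
Variables (O : Type) (M : machine O).

Definition odelta (q : state M) (s : 'I_(ntapes M).+1 -> symbol (letter M)) :
    set (state M * option bool * ('I_(ntapes M).+1 -> symbol (letter M) * move)) :=
  [set a | (a.1.1, a.1.2, [ffun i => a.2 i]) \in delta q [ffun i => s i]].

Lemma odelta_neq0 q s : odelta q s !=set0.
Proof.
have /card_gt0P[[[q' b] f] h] := delta_gt0 q [ffun i => s i].
exists (q', b, f : _ -> _); rewrite /odelta /=.
by rewrite (_ : [ffun i => f i] = f) //; apply/ffunP => i; rewrite ffunE.
Qed.

Definition gmachine_of : gmachine O :=
  @GMachine O 'I_(ntapes M).+1 ord0 (state M) (letter M) (start M)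
    (@mode_of O M) odelta odelta_neq0.

Definition gconfig_of (c : config M) : gconfig gmachine_of :=
  (c.1.1, fun i => stape_of (c.1.2 i), c.2).

Lemma gconfig_of_init x : gconfig_of (init M x) = ginit gmachine_of x.
Proof.
congr (_, _, _); apply/funext => i; rewrite /= ffunE; case: ifP => _ //.
  by rewrite /stape_of /= (nth_scat [::]) nth_scat.
by rewrite /stape_of /= (nth_scat [::]).
Qed.

Lemma gconfig_of_step D c c' : step D c c' ->
  gstep D (gconfig_of c) (gconfig_of c').
Proof.
case=> [q t w q' b f hq hd|q t w qy qn hq hD|q t w qy qn hq hD] /=; rewrite hq.
- exists (q', b, f : _ -> _); rewrite /= /odelta /=.
    rewrite (_ : [ffun i => f i] = f); last by apply/ffunP => i; rewrite ffunE.
    have -> // : [ffun i => sread (stape_of (t i))] = reads t.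
    by apply/ffunP => i; rewrite !ffunE sread_of.
  congr (_, _, _); apply/funext => i; rewrite ffunE stape_of_act /gacts /=.
  by case: (f i).
- by rewrite asboolT.
- by rewrite asboolF.
Qed.

Lemma step_gconfig_of D c d : gstep D (gconfig_of c) d ->
  exists2 c', step D c c' & gconfig_of c' = d.
Proof.
case: c => [[q t] w] /=; case hq: (mode_of q) => [//|qy qn|].
  move=> ->; case: asboolP => h; [exists (qy, t, [::])|exists (qn, t, [::])] => //.
    exact: step_yes hq h.
  exact: step_no hq h.
move=> [[[q' b] f]]; rewrite /= /odelta /= => h ->.
exists (q', update [ffun i => f i] t, w ++ wbit b).
  exact: step_work.
congr (_, _, _); apply/funext => i; rewrite !ffunE stape_of_act /gacts /=.
by case: (f i).
Qed.

Lemma gmachine_of_bound D x m :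
  (forall n c, run D (init M x) n c -> n <= m) -> gbound D m (ginit gmachine_of x).
Proof.
move=> h; rewrite -gconfig_of_init.
exact: (run_gbound (@gconfig_of_step D) (@step_gconfig_of D) _ _).1 h.
Qed.

Lemma gmachine_of_out D x o : out M D x o <-> gout D (ginit gmachine_of x) o.
Proof.
rewrite -gconfig_of_init; apply: run_gout => //.
  exact: gconfig_of_step.
exact: step_gconfig_of.
Qed.

End OfMachine.

(** * From machines on streams back to machines *)

Section Compile.
Variables (O : Type) (g : gmachine O).

Lemma gtape_gt0 : #|gtape g| = #|gtape g|.-1.+1.
Proof. by rewrite prednK //; apply/card_gt0P; exists (ginput g). Qed.

Let n := #|gtape g|.-1.

(* The transposition makes the input tape number 0. *)
Definition tape_num (i : gtape g) : 'I_n.+1 :=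
  tperm (cast_ord gtape_gt0 (enum_rank (ginput g))) ord0
    (cast_ord gtape_gt0 (enum_rank i)).

Definition tape_of_num (j : 'I_n.+1) : gtape g :=
  enum_val (cast_ord (esym gtape_gt0)
    (tperm (cast_ord gtape_gt0 (enum_rank (ginput g))) ord0 j)).

Lemma tape_numK : cancel tape_num tape_of_num.
Proof.
by move=> i; rewrite /tape_of_num /tape_num tpermK cast_ordK enum_rankK.
Qed.

Lemma tape_of_numK : cancel tape_of_num tape_num.
Proof.
by move=> j; rewrite /tape_of_num /tape_num enum_valK cast_ordKV tpermK.
Qed.

Lemma tape_num_input : tape_num (ginput g) = ord0.
Proof. by rewrite /tape_num tpermL. Qed.

Definition cdelta (q : gstate g) (s : {ffun 'I_n.+1 -> symbol (gletter g)}) :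
    {set action n (gstate g) (gletter g)} :=
  finset (fun a : action n (gstate g) (gletter g) =>
    `[< gdelta q (s \o tape_num) (a.1.1, a.1.2, a.2 \o tape_num : _ -> _) >]).

Lemma cdelta_neq0 q s : 0 < #|cdelta q s|.
Proof.
have [[[q' b] f] h] := gdelta_neq0 q (s \o tape_num).
apply/card_gt0P; exists (q', b, [ffun j => f (tape_of_num j)]); rewrite inE /=.
apply/asboolP; congr (gdelta _ _ (_, _, _)): h.
by apply/funext => i /=; rewrite ffunE tape_numK.
Qed.

Definition compile : machine O :=
  @Machine O n (gstate g) (gletter g) (gstart g) (@gmode O g) cdelta cdelta_neq0.

Definition gconf (c : config compile) : gconfig g :=
  (c.1.1, fun i => stape_of (c.1.2 (tape_num i)), c.2).

Lemma gconf_init x : gconf (init compile x) = ginit g x.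
Proof.
congr (_, _, _); apply/funext => i; rewrite /= ffunE.
rewrite -[ord0]tape_num_input (can_eq tape_numK); case: ifP => _ //.
  by rewrite /stape_of /= (nth_scat [::]) nth_scat.
by rewrite /stape_of /= (nth_scat [::]).
Qed.

Lemma gconf_step D c c' : step D c c' -> gstep D (gconf c) (gconf c').
Proof.
case=> [q t w q' b f hq hd|q t w qy qn hq hD|q t w qy qn hq hD] /=;
  rewrite /= in hq; rewrite hq.
- exists (q', b, f \o tape_num).
    move: hd; rewrite inE /= => /asboolP; congr (gdelta _ _ _).
    by apply/funext => i /=; rewrite ffunE.
  congr (_, _, _); apply/funext => i; rewrite ffunE stape_of_act /gacts /=.
  by case: (f _).
- by rewrite asboolT.
- by rewrite asboolF.
Qed.

Lemma step_gconf D c d : gstep D (gconf c) d ->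
  exists2 c', step D c c' & gconf c' = d.
Proof.
case: c => [[q t] w] /=; case hq: (gmode q) => [//|qy qn|].
  move=> ->; case: asboolP => h; [exists (qy, t, [::])|exists (qn, t, [::])] => //.
    exact: (step_yes (M := compile)) hq h.
  exact: (step_no (M := compile)) hq h.
move=> [[[q' b] f]] /= h ->.
exists (q', update (M := compile) [ffun j => f (tape_of_num j)] t, w ++ wbit b).
  apply: (step_work (M := compile)) => //; rewrite inE /=; apply/asboolP.
  congr (gdelta _ _ (_, _, _)): h; apply/funext => i /=.
    by rewrite ffunE.
  by rewrite ffunE tape_numK.
congr (_, _, _); apply/funext => i; rewrite !ffunE stape_of_act /gacts /= tape_numK.
by case: (f i).
Qed.

Lemma compile_bound D x m : gbound D m (ginit g x) ->
  forall k c, run D (init compile x) k c -> k <= m.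
Proof.
move=> h; rewrite -gconf_init in h.
exact: (run_gbound (@gconf_step D) (@step_gconf D) _ _).2 h.
Qed.

Lemma compile_out D x o : out compile D x o <-> gout D (ginit g x) o.
Proof.
rewrite -gconf_init; apply: run_gout => //.
  exact: gconf_step.
exact: step_gconf.
Qed.

Lemma compile_deterministic :
  (forall (q : gstate g) s, exists a, gdelta q s = [set a]) -> deterministic compile.
Proof.
move=> h q s; have [[[q' b] f] e] := h q (s \o tape_num).
apply/eqP/cards1P; exists (q', b, [ffun j => f (tape_of_num j)]).
apply/setP => -[[q1 b1] f1]; rewrite !inE /= e; apply/asboolP/eqP => /=.
  move=> [-> -> <-]; congr (_, _, _); apply/ffunP => j.
  by rewrite ffunE /= tape_of_numK.
move=> [-> -> ->]; congr (_, _, _); apply/funext => i.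
by rewrite /= ffunE tape_numK.
Qed.

End Compile.

(** * The nondeterministic verifier *)

(** [ERestart] is not an event of a path of N. It takes the place of the answer no when Y gives that
    answer but B contains the word just written. *)
Inductive event :=
  EWrite of bool | EQuery of bool | EHalt of bool | ERestart.

Definition sum_of_event (e : event) : option (bool + (bool + bool)) :=
  match e with
  | EWrite b => Some (inl b)
  | EQuery b => Some (inr (inl b))
  | EHalt b => Some (inr (inr b))
  | ERestart => None
  end.

Definition event_of_sum (s : option (bool + (bool + bool))) : event :=
  match s with
  | Some (inl b) => EWrite b
  | Some (inr (inl b)) => EQuery b
  | Some (inr (inr b)) => EHalt b
  | None => ERestart
  end.

Lemma sum_of_eventK : cancel sum_of_event event_of_sum.
Proof. by case. Qed.

HB.instance Definition _ := Countable.copy event (can_type sum_of_eventK).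
HB.instance Definition _ : isFinite event := CanIsFinite sum_of_eventK.

(** The code 7 of [ERestart] falls on the default value. It follows the code 6 of [EQuery false], so
    that one more 1 turns a refuted answer no into a restart. *)
Definition event_of_nat (i : nat) : event :=
  nth ERestart [:: ERestart; EWrite false; EWrite true; EHalt true; EHalt false;
                   EQuery true; EQuery false] i.

Definition nat_of_event (e : event) : nat :=
  match e with
  | EWrite false => 1 | EWrite true => 2
  | EHalt true => 3 | EHalt false => 4
  | EQuery true => 5 | EQuery false => 6
  | ERestart => 7
  end.

Lemma nat_of_eventK : cancel nat_of_event event_of_nat.
Proof. by do 2?case. Qed.

(* The transcript s has its most recent event first.  Unary codes let the driver
   try the next event by putting one more 1 in front; the code 0 ends the
   transcript. *)
Definition code (s : seq event) (x : word) : word :=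
  foldr (fun e w => nseq (nat_of_event e) true ++ false :: w) (false :: x) s.

Definition consume (v : seq event) (e : event) : option (seq event) :=
  if v is e' :: v' then if e' == e then Some v' else None else Some [::].

Definition verdict (o : outcome) : option bool :=
  match o with Acc => Some true | Rej => Some false | Unknown => None end.

(* The items are reversed words, because the oracle tape is scanned from its right
   end; in the flat list None precedes each item. *)
Fixpoint scan (z0 : word) (m : bool) (z : word) (ys : seq (option bool)) : bool :=
  match ys with
  | [::] => m && (z == [::])
  | Some b :: ys' =>
    if z is c :: z' then
      if m && (b == c) then scan z0 true z' ys' else scan z0 false z ys'
    else scan z0 false z ys'
  | None :: ys' => if m && (z == [::]) then true else scan z0 true z0 ys'
  end.

(** No item is open before the first [None], so the scan starts with the flag [false]. *)
Definition lookup (ys : seq (option bool)) : language :=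
  [set u | scan (rev u) false (rev u) ys].

(* The transcript is read from its most recent event backwards.  The phase is
   None while reading the current log, Some true while reading the query that
   led to a restart, and Some false while skipping the rest of an older log. *)
Definition next_phase (ph : option bool) (e : event) : option bool :=
  match e with
  | ERestart => Some true
  | EWrite _ => ph
  | _ => omap (fun=> false) ph
  end.

Definition logged (ph : option bool) (e : event) : bool :=
  (ph == None) && (e != ERestart).

Definition emitted (ph : option bool) (e : event) : option (option bool) :=
  match e, ph with
  | ERestart, _ => Some None
  | EWrite b, Some true => Some (Some b)
  | _, _ => None
  end.

(** The counter [i] is the number of ones read in the current code. Reading backwards puts the log
    [v] in chronological order; the accumulator [ys] models a tape that grows to the right, hence
    the final reversal. *)
Fixpoint parse (ph : option bool) (i : nat) (v : seq event)
    (ys : seq (option bool)) (r : word) : option (seq event * seq (option bool) * word) :=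
  match r with
  | [::] => None
  | true :: r' => if i < 7 then parse ph i.+1 v ys r' else None
  | false :: r' =>
    if i == 0 then Some (v, rev ys, r')
    else let e := event_of_nat i in
      parse (next_phase ph e) 0 (if logged ph e then e :: v else v)
        (if emitted ph e is Some s then s :: ys else ys) r'
  end.

Section Match.
Variables (g : gmachine outcome) (D : language).

(* Once v is used up, the path is free to continue to any productive outcome. *)
Inductive matches : gconfig g -> seq event -> Prop :=
| matches_halt c v o b : gmode c.1.1 = Halt o -> verdict o = Some b ->
    consume v (EHalt b) -> matches c v
| matches_work q t u v a v' : gmode q = Work ->
    gdelta q (fun i => sread (t i)) a ->
    (if a.1.2 is Some b then consume v (EWrite b) else Some v) = Some v' ->
    matches (a.1.1, gacts a.2 t, u ++ wbit a.1.2) v' -> matches (q, t, u) v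
| matches_query q t u v v' qy qn : gmode q = Query qy qn ->
    consume v (EQuery `[< D u >]) = Some v' ->
    matches (if `[< D u >] then qy else qn, t, [::]) v' -> matches (q, t, u) v.

Lemma matchesE q t u v : matches (q, t, u) v ->
  match gmode q with
  | Halt o => exists2 b, verdict o = Some b & consume v (EHalt b)
  | Work => exists a v', [/\ gdelta q (fun i => sread (t i)) a,
      (if a.1.2 is Some b then consume v (EWrite b) else Some v) = Some v' &
      matches (a.1.1, gacts a.2 t, u ++ wbit a.1.2) v']
  | Query qy qn => exists2 v', consume v (EQuery `[< D u >]) = Some v' &
      matches (if `[< D u >] then qy else qn, t, [::]) v'
  end.
Proof.
move E: (q, t, u) => c h; case: c v / h E.
- by move=> c v o b h ho hv E; rewrite -E /= in h; rewrite h; exists b.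
- by move=> q' t' u' v a v' h hd hv r [-> -> ->]; rewrite h; exists a, v'.
- by move=> q' t' u' v v' qy qn h hv r [-> -> ->]; rewrite h; exists v'.
Qed.

End Match.

Section Verifier.
Variable g : gmachine outcome.

(** A query of [g] is answered in three phases. [KBack] returns to the left end of the item tape.
    [KScan] compares the items with the oracle word, starting at the right end of the latter; its
    flag says whether the current item agrees so far. [KRewind] brings the oracle head back to the
    right end, before the next item ([None]) or before giving an answer ([Some]). *)
Inductive kstate :=
  | KParse of option bool & 'I_8
  | KSim of gstate g
  | KBack of gstate g & gstate g
  | KScan of bool & gstate g & gstate g
  | KRewind of option bool & gstate g & gstate g
  | KHalt of bool.

Let Q := gstate g.
Let ksum : finType := (((option bool * 'I_8) + Q) + ((Q * Q) + (bool * Q * Q))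
  + ((option bool * Q * Q) + bool))%type.

Definition sum_of_kstate (st : kstate) : ksum :=
  match st with
  | KParse ph i => inl (inl (inl (ph, i)))
  | KSim q => inl (inl (inr q))
  | KBack q q' => inl (inr (inl (q, q')))
  | KScan m q q' => inl (inr (inr (m, q, q')))
  | KRewind r q q' => inr (inl (r, q, q'))
  | KHalt b => inr (inr b)
  end.

Definition kstate_of_sum (s : ksum) : kstate :=
  match s with
  | inl (inl (inl (ph, i))) => KParse ph i
  | inl (inl (inr q)) => KSim q
  | inl (inr (inl (q, q'))) => KBack q q'
  | inl (inr (inr (m, q, q'))) => KScan m q q'
  | inr (inl (r, q, q')) => KRewind r q q'
  | inr (inr b) => KHalt b
  end.

Lemma sum_of_kstateK : cancel sum_of_kstate kstate_of_sum.
Proof. by case. Qed.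

HB.instance Definition _ := Countable.copy kstate (can_type sum_of_kstateK).
HB.instance Definition _ : isFinite kstate := CanIsFinite sum_of_kstateK.

Definition kletter : finType := (gletter g + event)%type.
(* A log tape, an item tape and an oracle tape are added to the tapes of g. *)
Definition ktape : finType := option (option (option (gtape g))).

Let S0 := symbol (gletter g).
Let S := symbol kletter.

Definition kemb (s : S0) : S :=
  omap (fun c => match c with inl b => inl b | inr l => inr (inl l) end) s.

Definition kdec (s : S) : S0 :=
  match s with
  | Some (inl b) => Some (inl b)
  | Some (inr (inl l)) => Some (inr l)
  | _ => None
  end.

Lemma kembK : cancel kemb kdec.
Proof. by do 2?case. Qed.

Definition kbit (b : bool) : S := Some (inl b).
Definition kev (e : event) : S := Some (inr (inr e)).
Definition ksep : S := kev ERestart.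
Definition kitem (s : option bool) : S := if s is Some b then kbit b else ksep.
Definition is_bit (s : S) : bool := if s is Some (inl _) then true else false.

Definition expected (s : S) (e : event) : bool := (s == None) || (s == kev e).

(** Events are erased when consumed, so that the log tape keeps the form [log_tape v]. *)
Definition advance (s : S) : S * move := (None, if s == None then Stay else Right).

Let instr : Type :=
  (kstate * (gtape g -> S0 * move) * (S * move) * (S * move) * (S * move))%type.

Definition kacts (f : gtape g -> S0 * move) (aT aY aU : S * move) :
    ktape -> S * move :=
  fun i => match i with
  | None => aT
  | Some None => aY
  | Some (Some None) => aU
  | Some (Some (Some j)) => (kemb (f j).1, (f j).2)
  end.

Definition kdo (a : instr) : kstate * option bool * (ktape -> S * move) :=
  let: (st, f, aT, aY, aU) := a in (st, None, kacts f aT aY aU).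

(** The transcript is erased while it is read, so that the simulation finds the input tape as [g]
    has it initially on [x]. The separator put on the oracle tape marks the left end of the first
    query word. *)
Definition kdet (st : kstate) (s : gtape g -> S0) (sT sY sU : S)
    (sx : S0) : instr :=
  let stay := fun j => (s j, Stay) in
  let erase := fun j => if j == ginput g then (None, Right) else (s j, Stay) in
  let kT := (sT, Stay) in let kY := (sY, Stay) in let kU := (sU, Stay) in
  match st with
  | KParse ph i =>
    match sx with
    | Some (inl true) =>
      (if i < 7 then KParse ph (inord i.+1) else KHalt false, erase, kT, kY, kU)
    | Some (inl false) =>
      if i == 0 :> nat then
        (KSim (gstart g), erase, (None, Right), kY, (ksep, Right))
      else let e := event_of_nat i in
        (KParse (next_phase ph e) ord0, erase,
         if logged ph e then (kev e, Left) else kT,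
         if emitted ph e is Some y then (kitem y, Right) else kY, kU)
    | _ => (KHalt false, stay, kT, kY, kU)
    end
  | KSim q =>
    match gmode q with
    | Halt o =>
      (KHalt (if verdict o is Some b then expected sT (EHalt b) else false),
       stay, kT, kY, kU)
    | Query qy qn => (KBack qy qn, stay, kT, (sY, Left), kU)
    | Work => (st, stay, kT, kY, kU)
    end
  | KBack qy qn =>
    if sY == None then (KScan false qy qn, stay, kT, (None, Right), (sU, Left))
    else (st, stay, kT, (sY, Left), kU)
  | KScan m qy qn =>
    if is_bit sY then
      let m' := m && (sU == sY) in
      (KScan m' qy qn, stay, kT, (sY, Right), (sU, if m' then Left else Stay))
    else if m && ~~ is_bit sU then (KRewind (Some true) qy qn, stay, kT, kY, kU)
    else if sY == None then (KRewind (Some false) qy qn, stay, kT, kY, kU)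
    else (KRewind None qy qn, stay, kT, (sY, Right), kU)
  | KRewind r qy qn =>
    if sU == None then
      if r is Some a then
        if expected sT (EQuery a) then
          (KSim (if a then qy else qn), stay, advance sT, kY, (ksep, Right))
        else (KHalt false, stay, kT, kY, kU)
      else (KScan true qy qn, stay, kT, kY, (None, Left))
    else (st, stay, kT, kY, (sU, Right))
  | KHalt b => (st, stay, kT, kY, kU)
  end.

Definition kwork (s : gtape g -> S0) (sT sY sU : S)
    (a : Q * option bool * (gtape g -> S0 * move)) : instr :=
  if a.1.2 is Some b then
    if expected sT (EWrite b) then
      (KSim a.1.1, a.2, advance sT, (sY, Stay), (kbit b, Right))
    else (KHalt false, a.2, (sT, Stay), (sY, Stay), (sU, Stay))
  else (KSim a.1.1, a.2, (sT, Stay), (sY, Stay), (sU, Stay)).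

Definition works (st : kstate) : bool :=
  if st is KSim q then if gmode q is Work then true else false else false.

Definition kdelta (st : kstate) (s : ktape -> S) :
    set (kstate * option bool * (ktape -> S * move)) :=
  let s0 := fun j => kdec (s (Some (Some (Some j)))) in
  let sT := s None in let sY := s (Some None) in let sU := s (Some (Some None)) in
  match st with
  | KSim q =>
    if works st then [set kdo (kwork s0 sT sY sU a) | a in gdelta q s0]
    else [set kdo (kdet st s0 sT sY sU (s0 (ginput g)))]
  | _ => [set kdo (kdet st s0 sT sY sU (s0 (ginput g)))]
  end.

Lemma kdelta_neq0 st s : kdelta st s !=set0.
Proof.
rewrite /kdelta; case: st => [ph i|q|q q'|m q q'|r q q'|b]; try by eexists.
case: ifP => _; last by eexists.
set s0 := (X in gdelta _ X); have [a ha] := gdelta_neq0 (g := g) q s0.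
by eexists; exists a.
Qed.

Definition verifier : gmachine bool :=
  @GMachine bool ktape (Some (Some (Some (ginput g)))) kstate kletter
    (KParse None ord0) (fun st => if st is KHalt b then Halt b else Work)
    kdelta kdelta_neq0.

Definition ktapes (t : gtapes g) (T Y U : stape S) : gtapes verifier :=
  fun i => match i with
  | None => T
  | Some None => Y
  | Some (Some None) => U
  | Some (Some (Some j)) => smap kemb (t j)
  end.

Lemma gacts_kacts f aT aY aU t T Y U :
  gacts (g := verifier) (kacts f aT aY aU) (ktapes t T Y U) =
  ktapes (gacts f t) (act aT T) (act aY Y) (act aU U).
Proof.
apply/funext => -[[[j|]|]|] //=; rewrite /gacts /= act_smap.
by case: (f j).
Qed.

Variable D0 : language.

Lemma kgo st t T Y U st' f aT aY aU :
  ~~ works st -> (forall b, st <> KHalt b) ->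
  kdet st (fun j => sread (t j)) (sread T) (sread Y) (sread U)
    (sread (t (ginput g))) = (st', f, aT, aY, aU) ->
  go (g := verifier) D0 1 (st, ktapes t T Y U, [::])
    (st', ktapes (gacts f t) (act aT T) (act aY Y) (act aU U), [::]).
Proof.
move=> hw hh e; rewrite -gacts_kacts.
have s0 : (fun j => kdec (sread (smap kemb (t j)))) = (fun j => sread (t j)).
  by apply/funext => j; rewrite /sread /= kembK.
apply: (@go_work _ verifier D0 st _ _ st' None (kacts f aT aY aU)).
  by case: st hh {hw e} => //= b /(_ b).
transitivity [set kdo (kdet st (fun j => sread (t j)) (sread T) (sread Y) (sread U)
    (sread (t (ginput g))))]; last by rewrite e.
have s1 : kdec (sread (smap kemb (t (ginput g)))) = sread (t (ginput g)).
  by rewrite /sread /= kembK.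
rewrite /gdelta /verifier /kdelta /ktapes s0 s1.
by case: st hw {hh e} => //= q; case: (gmode q).
Qed.

Definition stay_acts (t : gtapes g) : gacts (fun j => (sread (t j), Stay)) t = t.
Proof. by apply/funext => j; rewrite /gacts act_stay. Qed.

Let bl := @blanks kletter.

Definition bits (z : word) : seq S := map kbit z.
Definition input (x : word) : gtapes g := (ginit g x).1.2.
Definition log_tape (v : seq event) : stape S := (bl, scat (map kev v) bl).
Definition item_tape (yl yr : seq (option bool)) : stape S :=
  (scat (map kitem yl) bl, scat (map kitem yr) bl).

Definition kconf (st : kstate) t T Y U : gconfig verifier := (st, ktapes t T Y U, [::]).

Lemma kgo1 st t T Y U st' f aT aY aU t' T' Y' U' :
  ~~ works st -> (forall b, st <> KHalt b) ->
  kdet st (fun j => sread (t j)) (sread T) (sread Y) (sread U)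
    (sread (t (ginput g))) = (st', f, aT, aY, aU) ->
  gacts f t = t' -> act aT T = T' -> act aY Y = Y' -> act aU U = U' ->
  go D0 1 (kconf st t T Y U) (kconf st' t' T' Y' U').
Proof. by move=> hw hh e <- <- <- <-; apply: kgo. Qed.

Lemma input_erase b x :
  gacts (fun j => if j == ginput g then (None, Right)
                  else (sread (input (b :: x) j), Stay)) (input (b :: x)) = input x.
Proof.
apply/funext => j; rewrite /gacts /input /=; case: eqP => // _.
  by rewrite /act /= scons_blank.
by rewrite /act /= scons_blank.
Qed.

Lemma sread_input x :
  sread (input x (ginput g)) = if x is b :: _ then Some (inl b) else None.
Proof. by rewrite /input /= eqxx; case: x. Qed.

(** Each letter costs one step. The log grows to the left of a head that scans a blank, the items
    grow to the right, which gives the orders used in [parse]. *)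
Lemma parse_go r ph (i : 'I_8) v yr :
  match parse ph i v yr r with
  | None => exists t T Y U, go D0 (size r).+1
     (kconf (KParse ph i) (input r) (bl, scons None (scat (map kev v) bl))
        (item_tape yr [::]) (bl, bl)) (kconf (KHalt false) t T Y U)
  | Some (v', ys, x) => go D0 (size r)
     (kconf (KParse ph i) (input r) (bl, scons None (scat (map kev v) bl))
        (item_tape yr [::]) (bl, bl))
     (kconf (KSim (gstart g)) (input x) (log_tape v') (item_tape (rev ys) [::])
        (scons ksep bl, bl))
  end.
Proof.
elim: r ph i v yr => [|[] r IH] ph i v yr /=.
- by do 4!eexists; apply: kgo; rewrite ?sread_input.
- case: ifP => hi; last first.
    do 4!eexists; apply: (go_leq (n := 1)) => //.
    by apply: kgo; rewrite ?sread_input //= hi.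
  have s : go D0 1
    (kconf (KParse ph i) (input (true :: r)) (bl, scons None (scat (map kev v) bl))
        (item_tape yr [::]) (bl, bl))
    (kconf (KParse ph (inord i.+1)) (input r) (bl, scons None (scat (map kev v) bl))
        (item_tape yr [::]) (bl, bl)).
    apply: kgo1 => //; [by rewrite sread_input /= hi|exact: input_erase|..];
      exact: act_stay.
  have := IH ph (inord i.+1) v yr; rewrite inordK //.
  case: parse => [[[v' ys] x]|]; first exact: go_trans s.
  by case=> [t [T [Y [U h]]]]; exists t, T, Y, U; apply: go_trans s h.
- case: ifP => hi.
    rewrite revK; apply: (go_leq (n := 1)) => //.
    apply: kgo1 => //; [by rewrite sread_input /= hi|exact: input_erase|..].
    + by rewrite /act /= scons_blank.
    + exact: act_stay.
    + by [].
  set e := event_of_nat i.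
  set v1 := if logged ph e then e :: v else v.
  set yr1 := if emitted ph e is Some s then s :: yr else yr.
  have s : go D0 1
    (kconf (KParse ph i) (input (false :: r)) (bl, scons None (scat (map kev v) bl))
        (item_tape yr [::]) (bl, bl))
    (kconf (KParse (next_phase ph e) ord0) (input r)
        (bl, scons None (scat (map kev v1) bl)) (item_tape yr1 [::]) (bl, bl)).
    apply: kgo1 => //; [by rewrite sread_input /= hi|exact: input_erase|..].
    + by rewrite /v1 -/e; case: (logged ph e) => //; exact: act_stay.
    + by rewrite /yr1 -/e; case: (emitted ph e) => [y|] //; exact: act_stay.
    + exact: act_stay.
  have := IH (next_phase ph e) ord0 v1 yr1.
  case: parse => [[[v' ys] x]|]; first exact: go_trans s.
  by case=> [t [T [Y [U h]]]]; exists t, T, Y, U; apply: go_trans s h.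
Qed.

Lemma back_go qy qn t T yl yr U U' : act (sread U, Left) U = U' ->
  go D0 (size yl).+1
    (kconf (KBack qy qn) t T (left_of (item_tape yl yr).1 (item_tape yl yr).2) U)
    (kconf (KScan false qy qn) t T (item_tape [::] (rev yl ++ yr)) U').
Proof.
move=> hU; elim: yl yr => [|y yl IH] yr.
  apply: kgo1; [by []|by []|by []|exact: stay_acts|exact: act_stay| |exact: hU].
  by rewrite /act /= scons_blank.
rewrite /= rev_cons cat_rcons -addn1 addnC.
apply: go_trans (IH (y :: yr)).
apply: kgo1; [by []|by []|by case: y|exact: stay_acts|exact: act_stay| |exact: act_stay].
by case: y.
Qed.

Section OracleWord.
Variable J : nat -> S.
Hypothesis J0 : J 0 = ksep.

(** [J] is what lies to the left of the current oracle word. Earlier query words are not erased but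
    cut off by a new separator, so only the first cell of [J] matters. *)
Definition word_tape (z y : word) : stape S :=
  (scat (bits z) J, scat (bits y) bl).

Lemma rewind_go r qy qn t T Y z y :
  go D0 (size y) (kconf (KRewind r qy qn) t T Y (word_tape z y))
    (kconf (KRewind r qy qn) t T Y (word_tape (rev y ++ z) [::])).
Proof.
elim: y z => [|b y IH] z; first exact: go0.
rewrite /= rev_cons cat_rcons -add1n; apply: go_trans (IH (b :: z)).
apply: kgo1; [by []|by []|by []|exact: stay_acts|exact: act_stay|exact: act_stay|by []].
Qed.

Lemma rewind_left_go r qy qn t T Y z y :
  go D0 (size y).+1
    (kconf (KRewind r qy qn) t T Y (left_of (word_tape z y).1 (word_tape z y).2))
    (kconf (KRewind r qy qn) t T Y (word_tape (rev y ++ z) [::])).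
Proof.
rewrite -add1n; apply: go_trans (rewind_go _ _ _ _ _ _ _ _).
have e : sread (left_of (word_tape z y).1 (word_tape z y).2) <> None.
  by case: z => [|b z] /=; rewrite /sread /= ?J0.
apply: kgo1; [by []|by []| |exact: stay_acts|exact: act_stay|exact: act_stay|].
  by rewrite /=; case: eqP => // e'; case: e.
by rewrite /act /left_of /= /sread /= scons_eta.
Qed.

Definition word_left (z y : word) : stape S :=
  left_of (word_tape z y).1 (word_tape z y).2.

Lemma sread_word_left z y :
  sread (word_left z y) = if z is c :: _ then kbit c else ksep.
Proof. by case: z => [|c z]; rewrite /sread /= ?J0. Qed.

Lemma word_left_end z : act (sread (word_tape z [::]), Left) (word_tape z [::]) = word_left z [::].
Proof. by rewrite /act /= scons_blank. Qed.

Arguments word_left : simpl never.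

Lemma sread_item yl yr :
  sread (item_tape yl yr) = if yr is y :: _ then kitem y else None.
Proof. by case: yr. Qed.

Lemma scan_go u qy qn t T yr yl m z y : rev z ++ y = u ->
  exists yl' yr' z' y', [/\ rev yl' ++ yr' = rev yl ++ yr, rev z' ++ y' = u &
  go D0 (size yr * (size u + 3)).+1
    (kconf (KScan m qy qn) t T (item_tape yl yr) (word_left z y))
    (kconf (KRewind (Some (scan (rev u) m z yr)) qy qn) t T (item_tape yl' yr')
       (word_left z' y'))].
Proof.
elim: yr yl m z y => [|[b|] yr IH] yl m z y hu.
- exists yl, [::], z, y; split=> //.
  have e : sread (item_tape yl [::]) = None by [].
  have [h|h] := boolP (m && (z == [::])).
    apply: kgo1; [by []|by []| |exact: stay_acts|exact: act_stay|exact: act_stay|exact: act_stay].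
    by rewrite e /= h; case/andP: h => -> /eqP ->; rewrite sread_word_left.
  apply: kgo1; [by []|by []| |exact: stay_acts|exact: act_stay|exact: act_stay|exact: act_stay].
  rewrite e sread_word_left /= (negPf h).
  by case: m z {hu} h => [] [].
(* Either the letters agree, or the flag becomes false; the latter also happens when [z] is
   exhausted, where the oracle head scans a separator. *)
- have [[c [z' [mt ez eb]]]|h] : (exists c z', [/\ m, z = c :: z' & b == c]) \/
      m && (sread (word_left z y) == kbit b) = false.
    rewrite sread_word_left; case: m; last by right.
    case: z hu => [|c z'] _; first by right.
    have [->|ne] := eqVneq b c; [by left; exists c, z'|right].
    by apply/eqP => -[/esym/eqP]; rewrite (negPf ne).
  + have /(IH (Some b :: yl) true) [yl' [yr' [z1 [y1 [e1 e2 h]]]]] : rev z' ++ (c :: y) = u.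
      by rewrite -cat_rcons -rev_cons -ez.
    exists yl', yr', z1, y1; split=> //; first by rewrite e1 rev_cons cat_rcons.
    rewrite {2}ez /= mt eb.
    apply: (go_leq (n := 1 + (size yr * (size u + 3)).+1)); first by rewrite /=; lia.
    apply: go_trans h.
    rewrite ez -(eqP eb).
    apply: kgo1; [by []|by []|by rewrite sread_word_left sread_item /= eqxx|exact: stay_acts
      |exact: act_stay|by []|by []].
  + have [yl' [yr' [z1 [y1 [e1 e2 h']]]]] := IH (Some b :: yl) false z y hu.
    exists yl', yr', z1, y1; split=> //; first by rewrite e1 rev_cons cat_rcons.
    have -> : scan (rev u) m z (Some b :: yr) = scan (rev u) false z yr.
      move: h; rewrite sread_word_left; case: z {hu h' IH} => //= c z; clear e1.
      by case: m => //; move: b c => [] [].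
    apply: (go_leq (n := 1 + (size yr * (size u + 3)).+1)); first by rewrite /=; lia.
    apply: go_trans h'.
    apply: kgo1; [by []|by []|by rewrite sread_item /= h|exact: stay_acts
      |exact: act_stay|by []|exact: act_stay].
- have [h|h] := boolP (m && (z == [::])).
    exists yl, (None :: yr), z, y; split=> //=; rewrite h.
    apply: (go_leq (n := 1)) => //.
    apply: kgo1; [by []|by []| |exact: stay_acts|exact: act_stay|exact: act_stay|exact: act_stay].
    by rewrite /=; case/andP: h => -> /eqP ->; rewrite sread_word_left.
  have /(IH (None :: yl) true) [yl' [yr' [z1 [y1 [e1 e2 h']]]]] : rev (rev u) ++ [::] = u.
    by rewrite revK cats0.
  exists yl', yr', z1, y1; split=> //; first by rewrite e1 rev_cons cat_rcons.
  rewrite /= (negPf h).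
  have hs : size y <= size u by rewrite -hu size_cat leq_addl.
  apply: (go_leq (n := 1 + ((size y).+1 + (1 + (size yr * (size u + 3)).+1)))).
    by rewrite /=; lia.
  apply: (go_trans (d := kconf (KRewind None qy qn) t T (item_tape (None :: yl) yr)
    (word_left z y))).
    have hs' : (m && ~~ is_bit (sread (word_left z y))) = false.
      by rewrite sread_word_left; case: m z {hu IH hs e2} h => [] [|c z].
    by apply: kgo1; [by []|by []|by rewrite sread_item /= hs'|exact: stay_acts
      |exact: act_stay|by []|exact: act_stay].
  apply: go_trans (rewind_left_go _ _ _ _ _ _ _ _) _.
  have -> : rev y ++ z = rev u by rewrite -hu rev_cat revK.
  apply: go_trans h'.
  by apply: kgo1; [by []|by []|by []|exact: stay_acts|exact: act_stay|exact: act_stay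
    |exact: word_left_end].
Qed.

End OracleWord.

Lemma expectedE v e : expected (sread (log_tape v)) e = isSome (consume v e).
Proof.
case: v => [|e' v] //; rewrite /expected /sread /= (inj_eq (@Some_inj _)).
by rewrite (inj_eq (@inr_inj _ _)) (inj_eq (@inr_inj _ _)); case: eqP.
Qed.

Lemma advance_log v e v' : consume v e = Some v' ->
  act (advance (sread (log_tape v))) (log_tape v) = log_tape v'.
Proof.
case: v => [|e' v] /=; first by case=> <-; rewrite /act /= scons_blank.
by case: eqP => // _ [<-]; rewrite /act /= scons_blank.
Qed.


(** The query moves the head of the item tape and buries the word in [J'], but the list of items,
    [rev yl ++ yr], is preserved. *)
Lemma query_go J q qy qn t v yl yr u : J 0 = ksep -> gmode q = Query qy qn ->
  let a := scan (rev u) false (rev u) (rev yl ++ yr) in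
  let C := (size yl + size yr).+1 * (size u + 5) in
  let c := kconf (KSim q) t (log_tape v) (item_tape yl yr) (word_tape J (rev u) [::]) in
  if consume v (EQuery a) is Some v' then
    exists yl' yr' J', [/\ rev yl' ++ yr' = rev yl ++ yr, J' 0 = ksep &
      go D0 C c (kconf (KSim (if a then qy else qn)) t (log_tape v')
        (item_tape yl' yr') (word_tape J' [::] [::]))]
  else exists t' T Y U, go D0 C c (kconf (KHalt false) t' T Y U).
Proof.
move=> J0 hq a C c.
have hw : works (KSim q) = false by rewrite /= hq.
have s1 : go D0 1 c (kconf (KBack qy qn) t (log_tape v)
    (left_of (item_tape yl yr).1 (item_tape yl yr).2) (word_tape J (rev u) [::])).
  apply: kgo1; [by rewrite hw|by []|by rewrite /= hq|exact: stay_acts|exact: act_stay|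
    |exact: act_stay].
  case: yr {a C c} => [|y yr] //.
  by rewrite /act /= scons_blank.
have s2 := @back_go qy qn t (log_tape v) yl yr _ _ (word_left_end J (rev u)).
have e0 : rev (rev u) ++ [::] = u by rewrite revK cats0.
have [yl' [yr' [z [y [e1 e2 s3]]]]] :=
  scan_go J0 qy qn t (log_tape v) (rev yl ++ yr) [::] false e0.
have s4 := rewind_left_go J0 (Some a) qy qn t (log_tape v) (item_tape yl' yr') z y.
have e3 : rev y ++ z = rev u by rewrite -e2 rev_cat revK.
rewrite e3 in s4.
have hs : size y <= size u by rewrite -e2 size_cat leq_addl.
have s := go_trans s1 (go_trans s2 (go_trans s3 s4)).
have hC : 1 + ((size yl).+1 + ((size (rev yl ++ yr) * (size u + 3)).+1 + (size y).+1))
    + 1 <= C.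
  by rewrite size_cat size_rev /C; nia.
have r0 : sread (word_tape J (rev u) [::]) = None by [].
have := expectedE v (EQuery a); case hv: (consume v (EQuery a)) => [v'|] hx.
  exists yl', yr', (scons ksep (scat (bits (rev u)) J)); split=> //.
  apply: go_leq hC _; apply: go_trans s _.
  apply: kgo1; [by []|by []|by rewrite /= r0 /= hx|exact: stay_acts
    |exact: advance_log hv|exact: act_stay|by []].
do 4!eexists; apply: go_leq hC _; apply: go_trans s _.
apply: kgo1; [by []|by []|by rewrite /= r0 /= hx|exact: stay_acts
  |exact: act_stay|exact: act_stay|exact: act_stay].
Qed.

Lemma kwork_step q t T Y U d : gmode q = Work ->
  gstep D0 (kconf (KSim q) t T Y U) d <->
  exists2 a, gdelta q (fun j => sread (t j)) a &
    d = if a.1.2 is Some b then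
          if expected (sread T) (EWrite b) then
            kconf (KSim a.1.1) (gacts a.2 t) (act (advance (sread T)) T) Y
              (act (kbit b, Right) U)
          else kconf (KHalt false) (gacts a.2 t) T Y U
        else kconf (KSim a.1.1) (gacts a.2 t) T Y U.
Proof.
move=> hq.
have s0 : (fun j => kdec (sread (smap kemb (t j)))) = (fun j => sread (t j)).
  by apply/funext => j; rewrite /sread /= kembK.
have e a : (let: d' := kdo (kwork (fun j => sread (t j)) (sread T) (sread Y) (sread U) a) in
     (d'.1.1, gacts (g := verifier) d'.2 (ktapes t T Y U), [::] ++ wbit d'.1.2)) =
   if a.1.2 is Some b then
          if expected (sread T) (EWrite b) then
            kconf (KSim a.1.1) (gacts a.2 t) (act (advance (sread T)) T) Y
              (act (kbit b, Right) U)
          else kconf (KHalt false) (gacts a.2 t) T Y U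
        else kconf (KSim a.1.1) (gacts a.2 t) T Y U.
  case: a => [[q' [b|]] f] /=; rewrite /kwork /=; last first.
    by rewrite gacts_kacts !act_stay.
  by case: ifP => _ /=; rewrite gacts_kacts !act_stay.
have kd : kdelta (KSim q) (fun i => sread (ktapes t T Y U i)) =
    [set kdo (kwork (fun j => sread (t j)) (sread T) (sread Y) (sread U) a)
       | a in gdelta q (fun j => sread (t j))].
  by rewrite /kdelta /works hq /= s0.
have -> : gstep D0 (kconf (KSim q) t T Y U) d =
    exists2 d', kdelta (KSim q) (fun i => sread (ktapes t T Y U i)) d' &
      d = (d'.1.1, gacts (g := verifier) d'.2 (ktapes t T Y U), [::] ++ wbit d'.1.2).
  by [].
rewrite kd.
split=> [[_ [a ha <-] ->]|[a ha ->]]; first by exists a; rewrite -?e.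
by rewrite -e; eexists; first by exists a.
Qed.

Lemma gbound_khalt m b t T Y U : gbound D0 m (kconf (KHalt b) t T Y U).
Proof. exact: (@gbound_halt _ verifier D0 m (kconf (KHalt b) t T Y U) b). Qed.

Lemma gout_khalt b t T Y U : gout D0 (kconf (KHalt b) t T Y U) true <-> b.
Proof.
rewrite (gout_haltE D0 true (c := kconf (KHalt b) t T Y U) (erefl (Halt b))).
by split=> [<-|->].
Qed.

Lemma sim_halt q o t v u yl yr J : gmode q = Halt o ->
  let c := kconf (KSim q) t (log_tape v) (item_tape yl yr) (word_tape J (rev u) [::]) in
  gbound D0 1 c /\
  (gout D0 c true <-> matches (lookup (rev yl ++ yr)) (q, t, u) v).
Proof.
move=> hq c.
pose r := if verdict o is Some b then isSome (consume v (EHalt b)) else false.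
have e : (if verdict o is Some b then expected (sread (log_tape v)) (EHalt b) else false) = r.
  by rewrite /r; case: (verdict o) => // b; exact: expectedE.
have s : go D0 1 c (kconf (KHalt r) t (log_tape v) (item_tape yl yr)
    (word_tape J (rev u) [::])).
  apply: kgo1; [by rewrite /= hq|by []|by rewrite /= hq e|exact: stay_acts|exact: act_stay
    |exact: act_stay|exact: act_stay].
split.
  exact: (@go_bound _ _ _ 1 0 _ _ s (gbound_khalt _ _ _ _ _ _)).
rewrite (go_out _ s) gout_khalt /r; split.
  case ho: (verdict o) => [b|] // h.
  exact: matches_halt ho h.
by move=> /matchesE; rewrite hq => -[b ->].
Qed.

(** Induction on the time left to [g]. A step writes at most one bit, so [size u + m] never grows;
    hence [P] bounds every oracle word, and a step of [g] costs at most [(size ys).+1 * (P + 5)].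
    The additional round in [m.+1] pays for the halting step. *)
Lemma sim m q t v u yl yr ys J P : rev yl ++ yr = ys -> J 0 = ksep ->
  gbound (lookup ys) m (q, t, u) -> size u + m <= P ->
  let c := kconf (KSim q) t (log_tape v) (item_tape yl yr) (word_tape J (rev u) [::]) in
  gbound D0 (m.+1 * ((size ys).+1 * (P + 5))) c /\
  (gout D0 c true <-> matches (lookup ys) (q, t, u) v).
Proof.
have C0 : 0 < (size ys).+1 * (P + 5) by rewrite muln_gt0 addnS.
elim: m q t v u yl yr J => [|m IH] q t v u yl yr J hys J0 hb hP c.
all: case hq: (gmode q) => [o|qy qn|].
all: try by have [b1 b2] := sim_halt t v u yl yr J hq; rewrite hys in b2; split=> //;
  apply: gbound_leq b1; rewrite muln_gt0.
- by case: (hb (if `[< lookup ys u >] then qy else qn, t, [::])); rewrite /= hq.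
- have [a ha] := gdelta_neq0 (g := g) q (fun i => sread (t i)).
  by case: (hb (a.1.1, gacts a.2 t, u ++ wbit a.1.2)); rewrite /= hq; exists a.
- have := query_go t v yl yr u J0 hq; rewrite hys /=.
  set a := scan _ _ _ _; set C := _.+1 * _.
  have hC : C <= (size ys).+1 * (P + 5).
    by rewrite /C -hys size_cat size_rev leq_mul2l leq_add2r orbC (leq_trans _ hP) // leq_addr.
  have ea : `[< lookup ys u >] = a by apply/asboolP/idP.
  have hb' : gbound (lookup ys) m (if a then qy else qn, t, [::]).
    by apply: hb; rewrite /= hq ea.
  case hv: (consume v (EQuery a)) => [v'|].
    move=> [yl' [yr' [J' [e1 e2 s]]]].
    have [|b1 b2] := IH _ t v' [::] yl' yr' J' e1 e2 hb'; first by move: hP; rewrite /=; lia.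
    split.
      by rewrite mulSn; apply: gbound_leq (go_bound s b1); rewrite leq_add2r.
    rewrite (go_out _ s) b2; split=> h.
      by apply: matches_query hq _ _; rewrite ea; [exact: hv|].
    have := matchesE h; rewrite hq ea => -[v''].
    by rewrite hv => -[<-].
  move=> [t' [T [Y [U s]]]]; split.
    apply: gbound_leq (go_bound s (gbound_khalt 0 _ _ _ _ _)).
    by rewrite addn0 mulSn; apply: leq_trans hC (leq_addr _ _).
  rewrite (go_out _ s) gout_khalt; split=> // /matchesE; rewrite hq ea.
  by rewrite hv => -[].
- have key a : gdelta q (fun j => sread (t j)) a -> forall v',
      (if a.1.2 is Some b then consume v (EWrite b) else Some v) = Some v' ->
      let u' := u ++ wbit a.1.2 in
      let c' := kconf (KSim a.1.1) (gacts a.2 t) (log_tape v') (item_tape yl yr)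
                  (word_tape J (rev u') [::]) in
      gbound D0 (m.+1 * ((size ys).+1 * (P + 5))) c' /\
      (gout D0 c' true <-> matches (lookup ys) (a.1.1, gacts a.2 t, u') v').
    move=> ha v' hv; apply: IH => //; first by apply: hb; rewrite /= hq; exists a.
    rewrite size_cat; have : size (wbit a.1.2) <= 1 by case: (a.1.2).
    by move: hP; lia.
  split.
    apply: (gbound_leq (m := (m.+1 * ((size ys).+1 * (P + 5))).+1)).
      by rewrite mulSn -add1n leq_add2r.
    move=> d /kwork_step - /(_ hq) [a ha ->].
    have := key a ha; case: a ha => [[q' [b|]] f] /= ha k.
      have := expectedE v (EWrite b); case hv: (consume v (EWrite b)) => [v'|] -> /=.
        by rewrite (advance_log hv); have [] := k _ hv; rewrite cats1 rev_rcons.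
      exact: gbound_khalt.
    by have [] := k _ erefl; rewrite cats0.
  rewrite (@gout_stepE _ _ D0 c) //; split.
    move=> [d /kwork_step - /(_ hq) [a ha ->]].
    have := key a ha; case: a ha => [[q' [b|]] f] /= ha k.
      have := expectedE v (EWrite b); case hv: (consume v (EWrite b)) => [v'|] -> /=.
        rewrite (advance_log hv); have [_] := k _ hv; rewrite cats1 rev_rcons => -> h.
        by apply: matches_work hq ha hv _; rewrite /= cats1.
      by move/gout_khalt.
    have [_] := k _ erefl; rewrite cats0 => -> h.
    by apply: matches_work hq ha erefl _; rewrite /= cats0.
  move=> /matchesE; rewrite hq => -[a [v' [ha hv h]]].
  have [_ k] := key a ha v' hv.
  eexists; first by apply/kwork_step => //; exists a.
  move: h; rewrite -k; case: a ha hv k => [[q' [b|]] f] /= ha hv k.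
    have := expectedE v (EWrite b); rewrite hv => -> /=.
    by rewrite (advance_log hv) cats1 rev_rcons.
  by case: hv => <-; rewrite cats0.
Qed.

Lemma smap_sbits x : smap kemb (@blanks _, sbits g x) = (bl, sbits verifier x).
Proof.
congr pair; apply/funext => n /=; rewrite /sbits /comp; elim: x n => [|b x IH] [|n] //=.
Qed.

Lemma ginit_verifier x : ginit verifier x =
  kconf (KParse None ord0) (input x) (bl, scons None bl) (item_tape [::] [::]) (bl, bl).
Proof.
congr (_, _, _); apply/funext => -[[[j|]|]|] //=; last by rewrite scons_blank.
rewrite (inj_eq (@Some_inj _)) (inj_eq (@Some_inj _)) (inj_eq (@Some_inj _)).
by rewrite /input /=; case: ifP => _ //; rewrite smap_sbits.
Qed.

End Verifier.

Lemma parse_size ph i v ys r v' ys' x : parse ph i v ys r = Some (v', ys', x) ->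
  size x <= size r /\ size ys' <= size ys + size r.
Proof.
elim: r ph i v ys => [|[] r IH] ph i v ys //=.
  by case: ifP => // _ /IH; lia.
case: ifP => _; first by case=> _ <- <-; rewrite size_rev; lia.
by move=> /IH; case: emitted => [s|] /=; lia.
Qed.

(** The first summand is for parsing. Then at most [n] cells hold items, and oracle words have
    length at most [p n]. *)
Definition verifier_time (p : nat -> nat) (n : nat) : nat :=
  n.+1 + (p n).+1 * (n.+1 * (p n + 5)).

(** The simulated oracle is [lookup ys], whatever [D0] is, and [ys] comes from the input; so the
    time bound of [g] is taken for all oracles. *)
Lemma verifier_spec (g : gmachine outcome) (p : nat -> nat) D0 w :
  {homo p : m n / m <= n} ->
  (forall D x, gbound D (p (size x)) (ginit g x)) ->
  gbound D0 (verifier_time p (size w)) (ginit (verifier g) w) /\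
  (gout D0 (ginit (verifier g) w) true <->
   if parse None 0 [::] [::] w is Some (v, ys, x)
   then matches (lookup ys) (ginit g x) v else False).
Proof.
move=> hp hb; rewrite ginit_verifier.
have := @parse_size None 0 [::] [::] w.
have := parse_go g D0 w None ord0 [::] [::].
case: parse => [[[v ys] x]|]; last first.
  move=> [t [T [Y [U s]]]] _; split.
    apply: gbound_leq (go_bound s (gbound_khalt _ 0 _ _ _ _ _)).
    by rewrite addn0 leq_addr.
  by rewrite (go_out _ s) gout_khalt.
move=> s /(_ _ _ _ erefl) [hx hys].
have e0 : rev (rev ys) ++ [::] = ys by rewrite revK cats0.
have J0 : scons (ksep g) (@blanks (kletter g)) 0 = ksep g by [].
have [b1 b2] := sim D0 v (u := [::]) e0 J0 (hb (lookup ys) x) (leqnn _).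
split; last by rewrite (go_out _ s) b2.
apply: gbound_leq (go_bound s b1).
have := hp _ _ hx; rewrite /verifier_time /= in hys *; move: (p _) (p _) => a b hab.
rewrite add0n; apply: leq_add; first exact: leqnSn.
apply: leq_mul => //; apply: leq_mul => //.
by rewrite leq_add2r.
Qed.

(** * The log and the list of words described by a transcript *)

Fixpoint last_query (s : seq event) : word :=
  if s is EWrite b :: s' then b :: last_query s' else [::].

(** The most recent event comes first, so [last_query] yields the oracle tape reversed, which is the
    form in which items are stored. *)
Fixpoint items (s : seq event) : seq word :=
  match s with
  | [::] => [::]
  | ERestart :: s' => last_query s' :: items s'
  | _ :: s' => items s'
  end.

Fixpoint log (s : seq event) : seq event :=
  match s with
  | [::] | ERestart :: _ => [::]
  | e :: s' => rcons (log s') e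
  end.

Definition flat (its : seq word) : seq (option bool) :=
  flatten [seq None :: map Some z | z <- its].

Lemma parse_ones ph k i v ys r : i + k <= 7 ->
  parse ph i v ys (nseq k true ++ r) = parse ph (i + k) v ys r.
Proof.
elim: k i => [|k IH] i h /=; first by rewrite addn0.
by rewrite IH ?addSnnS // ifT //; move: h; lia.
Qed.

(** Generalized over the phase: in phase [Some true] the writes at the front of [s] complete the
    item that a restart has opened, and in both phases other than [None] the log is already
    closed. *)
Lemma parse_code ph v ys s x :
  parse ph 0 v ys (code s x) =
  Some (if ph == None then log s ++ v else v,
        rev ys ++ (if ph == Some true then map Some (last_query s) else [::])
        ++ flat (items s), x).
Proof.
elim: s ph v ys => [|e s IH] ph v ys /=.
  by rewrite !if_same !cats0; case: ph => [[]|] //=; rewrite ?cats0.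
rewrite parse_ones ?add0n; last by case: e => [[]|[]|[]|].
rewrite /= nat_of_eventK ifF; last by case: e => [[]|[]|[]|].
rewrite IH; congr (Some (_, _, _)).
  by case: e ph => [b|b|b|] [[]|] //=; rewrite cat_rcons.
by case: e ph => [b|b|b|] [[]|] //=; rewrite ?rev_cons ?cat_rcons //.
Qed.

Lemma lookup_flat its u : lookup (flat its) u <-> rev u \in its.
Proof.
rewrite /lookup /=; move: (rev u) => z0.
(* The situation inside an item: [y] is its unread rest and [z] the unmatched rest of the word. *)
have h y z m : scan z0 m z (map Some y ++ flat its) = (m && (z == y)) || (z0 \in its).
  elim: its y z m => [|it its IH] y z m.
    elim: y z m => [|b y IHy] z m /=; first by rewrite orbF.
    case: z => [|c z]; first by rewrite IHy !andbF.
    by case: m => /=; rewrite ?IHy //= eqseq_cons [b == c]eq_sym; case: eqP => //=; rewrite IHy.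
  elim: y z m => [|b y IHy] z m /=.
    rewrite inE; case: ifP => _ //=.
  case: z => [|c z]; first by rewrite IHy !andbF.
  by case: m => /=; rewrite ?IHy //= eqseq_cons [b == c]eq_sym; case: eqP => //=; rewrite IHy.
by have := h [::] z0 false => /= ->.
Qed.

(** * The deterministic driver *)

Definition digits_value (m k : nat) (a : nat -> nat) : nat := \sum_(i < k) a i * m ^ i.

(** Subtracting one turns the zeros at the low end into the largest digit and lowers the first
    nonzero digit. If all [k] digits vanish the value wraps around, which the last term records; in
    this form the claim passes from [k] to [k.+1]. *)
Lemma digits_pred m k (a : nat -> nat) :
  let carry i := all (fun j => a j == 0) (iota 0 i) in
  digits_value m.+1 k (fun i => if carry i then (if a i == 0 then m else (a i).-1) else a i)
    + 1 = digits_value m.+1 k a + (if carry k then m.+1 ^ k else 0).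
Proof.
move=> carry; rewrite /digits_value; elim: k => [|k IH]; first by rewrite !big_ord0.
rewrite !big_ord_recr /= addnAC IH.
have -> : carry k.+1 = carry k && (a k == 0).
  by rewrite /carry -addn1 iotaD all_cat /= andbT.
case: (carry k) => /=; last by rewrite addnAC.
case: (a k) => [|c] /=; rewrite ?expnS; lia.
Qed.

Lemma digits_max m k : digits_value m.+1 k (fun=> m) + 1 = m.+1 ^ k.
Proof.
rewrite /digits_value; elim: k => [|k IH]; first by rewrite big_ord0.
by rewrite big_ord_recr /= addnAC IH expnS mulSn.
Qed.

Section Driver.
Variable g : gmachine bool.
Variable k : nat.

Let Q := gstate g.

(** [DStart], [DScan] and [DBack] set up the clock, and [DLoop] ticks. [DLeft i] and [DPush i] put a
    bit in front of the word, 0 if [i] is 0 and 1 otherwise. [DRun], [DUndo] and [DRestore] call the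
    decision procedure and undo the call, and [DAct i] carries out the event of code [i]. *)
Inductive dstate :=
  | DStart | DScan | DBack | DLoop | DReject
  | DLeft of 'I_8 | DPush of 'I_8 | DAct of 'I_8
  | DRun of Q & 'I_8
  | DUndo of bool & 'I_8
  | DRestore of bool & 'I_8.

Let dsum : finType := (('I_5 + ('I_3 * 'I_8)) + ((Q * 'I_8) + (bool * bool * 'I_8)))%type.

Definition sum_of_dstate (st : dstate) : dsum :=
  match st with
  | DStart => inl (inl (inord 0))
  | DScan => inl (inl (inord 1))
  | DBack => inl (inl (inord 2))
  | DLoop => inl (inl (inord 3))
  | DReject => inl (inl (inord 4))
  | DLeft i => inl (inr (inord 0, i))
  | DPush i => inl (inr (inord 1, i))
  | DAct i => inl (inr (inord 2, i))
  | DRun q i => inr (inl (q, i))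
  | DUndo b i => inr (inr (true, b, i))
  | DRestore b i => inr (inr (false, b, i))
  end.

Definition dstate_of_sum (s : dsum) : dstate :=
  match s with
  | inl (inl j) => nth DStart [:: DStart; DScan; DBack; DLoop; DReject] j
  | inl (inr (j, i)) => nth DStart [:: DLeft i; DPush i; DAct i] j
  | inr (inl (q, i)) => DRun q i
  | inr (inr (true, b, i)) => DUndo b i
  | inr (inr (false, b, i)) => DRestore b i
  end.

Lemma sum_of_dstateK : cancel sum_of_dstate dstate_of_sum.
Proof. by case => //= *; rewrite inordK. Qed.

HB.instance Definition _ := Countable.copy dstate (can_type sum_of_dstateK).
HB.instance Definition _ : isFinite dstate := CanIsFinite sum_of_dstateK.

(** One letter records a whole step: the overwritten symbol and the move on each tape. *)
Definition history : finType := {ffun gtape g -> symbol (gletter g) * move}.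
Definition dletter : finType := (gletter g + (history + bool))%type.
(* None is a history tape, the others are those of g and k clock tapes. *)
Definition dtape : finType := option (gtape g + 'I_k).

Let S0 := symbol (gletter g).
Let S := symbol dletter.

Definition demb (s : S0) : S :=
  omap (fun c => match c with inl b => inl b | inr l => inr (inl l) end) s.

Definition ddec (s : S) : S0 :=
  match s with
  | Some (inl b) => Some (inl b)
  | Some (inr (inl l)) => Some (inr l)
  | _ => None
  end.

Lemma dembK : cancel demb ddec.
Proof. by do 2?case. Qed.

Definition dhist (h : history) : S := Some (inr (inr (inl h))).
(** [true] marks the left end and [false] the right end, so a clock head travelling in direction
    [d i] has arrived when it scans [dend (d i)]. *)
Definition dend (b : bool) : S := Some (inr (inr (inr b))).

(* The bit of each clock tape tells whether its head travels to the left. *)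
Definition dirs : finType := {ffun 'I_k -> bool}.

Let instr : Type := ((dstate * dirs) * option bool * (gtape g -> S0 * move) *
  (S * move) * ('I_k -> S * move))%type.

Definition dacts (f : gtape g -> S0 * move) (aH : S * move) (aC : 'I_k -> S * move) :
    dtape -> S * move :=
  fun i => match i with
  | None => aH
  | Some (inl j) => (demb (f j).1, (f j).2)
  | Some (inr i) => aC i
  end.

Definition ddo (a : instr) : (dstate * dirs) * option bool * (dtape -> S * move) :=
  let: (st, b, f, aH, aC) := a in (st, b, dacts f aH aC).

Variable next : Q -> (gtape g -> S0) -> Q * option bool * (gtape g -> S0 * move).

(** During [DScan] the clock heads travel along with the input head, which leaves as many blanks
    between the two end marks as the input has letters. *)
Definition ddet (st : dstate) (d : dirs) (s : gtape g -> S0) (sH : S) (sC : 'I_k -> S)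
    (sx : S0) : instr :=
  let stay := fun j => (s j, Stay) in
  let on a := fun j => if j == ginput g then a else (s j, Stay) in
  let kH := (sH, Stay) in
  let kC := fun i => (sC i, Stay) in
  match st with
  | DStart => ((DScan, d), None, stay, kH, fun=> (dend true, Right))
  | DScan =>
    if sx == None then
      ((DBack, [ffun=> true]), None, on (sx, Left), kH, fun=> (dend false, Stay))
    else ((DScan, d), None, on (sx, Right), kH, fun i => (sC i, Right))
  | DBack =>
    if sx == None then ((DLoop, d), None, on (Some (inl false), Stay), kH, kC)
    else ((DBack, d), None, on (sx, Left), kH, kC)
  | DLoop =>
    let stop i := sC i == dend (d i) in
    let carry (i : 'I_k) := [forall j : 'I_k, (j < i) ==> stop j] in
    if [forall i, stop i] then ((DReject, d), None, stay, kH, kC)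
    else ((DLeft ord0, [ffun i => if carry i && stop i then ~~ d i else d i]), None,
          stay, kH,
          fun i => (sC i, if carry i && ~~ stop i then (if d i then Left else Right)
                          else Stay))
  | DLeft i => ((DPush i, d), None, on (sx, Left), kH, kC)
  | DPush i =>
    ((if i == 0 :> nat then DLeft (inord 1) else
      if i == 7 :> nat then DLoop else DRun (gstart g) i, d), None,
     on (Some (inl (i != 0 :> nat)), Stay), kH, kC)
  | DRun q i =>
    match gmode q with
    | Halt b => ((DUndo b i, d), None, stay, (sH, Left), kC)
    | Work => let a := next q s in
      ((DRun a.1.1 i, d), None, a.2,
       (dhist [ffun j => (s j, (a.2 j).2)], Right), kC)
    | Query _ _ => ((DReject, d), None, stay, kH, kC)
    end
  | DUndo b i =>
    if sH is Some (inr (inr (inl h))) then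
      ((DRestore b i, d), None, fun j => (s j, opposite (h j).2), kH, kC)
    else ((if b then DAct i else if i < 6 then DLeft (inord i.+1) else DReject, d),
          None, stay, kH, kC)
  | DRestore b i =>
    if sH is Some (inr (inr (inl h))) then
      ((DUndo b i, d), None, fun j => ((h j).1, Stay), (None, Left), kC)
    else ((DReject, d), None, stay, kH, kC)
  | DAct i =>
    ((DLoop, d), if event_of_nat i is EWrite b then Some b else None, stay, kH, kC)
  | DReject => ((st, d), None, stay, kH, kC)
  end.

(** A yes against an expected no leads to the seventh 1, the code of a restart. A no against an
    expected yes cannot occur while Y is contained in the oracle, and the driver simply goes on. *)
Definition dmode (st : dstate * dirs) : mode bool (dstate * dirs)%type :=
  match st.1 with
  | DAct i =>
    match event_of_nat i with
    | EHalt b => Halt b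
    | EQuery b => Query (if b then DLoop else DLeft (inord 7), st.2) (DLoop, st.2)
    | _ => Work
    end
  | DReject => Halt false
  | _ => Work
  end.

Definition ddelta (st : dstate * dirs) (s : dtape -> S) :
    set ((dstate * dirs) * option bool * (dtape -> S * move)) :=
  let s0 := fun j => ddec (s (Some (inl j))) in
  [set ddo (ddet st.1 st.2 s0 (s None) (fun i => s (Some (inr i))) (s0 (ginput g)))].

Lemma ddelta_neq0 st s : ddelta st s !=set0.
Proof. by eexists. Qed.

Definition driver : gmachine bool :=
  @GMachine bool dtape (Some (inl (ginput g))) (dstate * dirs)%type dletter
    (DStart, [ffun=> true]) dmode ddelta ddelta_neq0.

Definition dtapes (t : gtapes g) (H : stape S) (C : 'I_k -> stape S) : gtapes driver :=
  fun i => match i with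
  | None => H
  | Some (inl j) => smap demb (t j)
  | Some (inr i) => C i
  end.

Definition dconf (st : dstate) (d : dirs) t H C (U : word) : gconfig driver :=
  ((st, d), dtapes t H C, U).

Variable D : language.

Lemma dgo1 st d t H C U st' d' b f aH aC t' H' C' U' :
  dmode (st, d) = Work ->
  ddet st d (fun j => sread (t j)) (sread H) (fun i => sread (C i))
    (sread (t (ginput g))) = ((st', d'), b, f, aH, aC) ->
  gacts f t = t' -> act aH H = H' -> (forall i, act (aC i) (C i) = C' i) ->
  U ++ wbit b = U' ->
  go D 1 (dconf st d t H C U) (dconf st' d' t' H' C' U').
Proof.
move=> hw e <- <- hC <-.
have -> : dconf st' d' (gacts f t) (act aH H) C' (U ++ wbit b) =
    ((st', d'), gacts (g := driver) (dacts f aH aC) (dtapes t H C), U ++ wbit b).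
  congr (_, _, _); apply/funext => -[[j|i]|] //=.
    by rewrite /gacts /= act_smap; case: (f j).
  by rewrite /gacts /= hC.
have s0 : (fun j => ddec (sread (smap demb (t j)))) = (fun j => sread (t j)).
  by apply/funext => j; rewrite /sread /= dembK.
have s1 : ddec (sread (smap demb (t (ginput g)))) = sread (t (ginput g)).
  by rewrite /sread /= dembK.
apply: (@go_work _ driver D (st, d) _ _ (st', d') b (dacts f aH aC)) => //.
by rewrite /gdelta /driver /ddelta /dtapes s0 s1 e.
Qed.

Lemma dstay_acts (t : gtapes g) : gacts (fun j => (sread (t j), Stay)) t = t.
Proof. by apply/funext => j; rewrite /gacts act_stay. Qed.

Let bl := @blanks dletter.

Definition hist_tape (hs : seq history) : stape S := (scat (map dhist hs) bl, bl).
Definition hist_left (hs : seq history) : stape S := left_of (hist_tape hs).1 bl.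

Hypothesis nextP : forall q s, gdelta q s = [set next q s].
Hypothesis no_query : forall (q qy qn : Q), gmode q <> Query qy qn.

Lemma hist_pop hs h : act (None, Left) (hist_left (h :: hs)) = hist_left hs.
Proof. by rewrite /act /hist_left /= scons_blank. Qed.

(* The history lets a call to g be undone, which leaves its tapes as if blank for
   the next call. *)
Lemma run_undo D0 n (c c' : gconfig g) : go D0 n c c' ->
  forall i d C U hs0 b, exists hs,
    go D n (dconf (DRun c.1.1 i) d c.1.2 (hist_tape hs0) C U)
      (dconf (DRun c'.1.1 i) d c'.1.2 (hist_tape (hs ++ hs0)) C U) /\
    go D (2 * n) (dconf (DUndo b i) d c'.1.2 (hist_left (hs ++ hs0)) C U)
      (dconf (DUndo b i) d c.1.2 (hist_left hs0) C U).
Proof.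
move=> r; elim: n c c' / r => [n c|n c c1 c' hc _ IH] i d C U hs0 b.
  by exists [::]; split; exact: go0.
have := (hc c1).2 erefl; case: c hc => [[q t] w] hc /=.
case hq: (gmode q) => [//|qy qn|]; first by case: (no_query hq).
move=> [a]; rewrite nextP => -> e1.
pose h : history := [ffun j => (sread (t j), ((next q (fun i => sread (t i))).2 j).2)].
have [hs [r1 r2]] := IH i d C U (h :: hs0) b.
exists (rcons hs h); rewrite cat_rcons; split.
  rewrite -add1n; apply: go_trans r1; rewrite e1.
  apply: dgo1; [by []|by rewrite /= hq|by []|by []|by move=> j; exact: act_stay|by rewrite cats0].
rewrite mulnS addnC; apply: go_trans r2 _; rewrite e1 -[2]/(1 + 1) /=.
apply: go_trans.
  apply: dgo1; [by []|by []|by []|exact: act_stay|by move=> j; exact: act_stay|by rewrite cats0].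
apply: dgo1; [by []|by []| |exact: hist_pop|by move=> j; exact: act_stay|by rewrite cats0].
apply/funext => j; rewrite /gacts /h !ffunE; exact: act_undo.
Qed.

(* A digit of the clock is the distance from the head to the end of the tape that it
   is travelling to; a digit that is reset turns around instead of rewinding. *)
Definition clock_cell (n m : nat) : S :=
  if m == 0 then dend true else if m == n.+1 then dend false else None.

Definition clock_tape (n p : nat) : stape S :=
  (fun i => if i < p then clock_cell n (p.-1 - i) else None, fun i => clock_cell n (p + i)).

Definition clock_pos (n : nat) (left : bool) (a : nat) : nat := if left then a else n.+1 - a.

Lemma clock_right n p : act (clock_cell n p, Right) (clock_tape n p) = clock_tape n p.+1.
Proof.
rewrite /act /clock_tape /=; congr pair; apply/funext => -[|i] //=.
- by rewrite subn0.
- by rewrite ltnS; case: ifP => // _; congr clock_cell; lia.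
- by rewrite /stail addn1 addn0.
- by rewrite /stail; congr clock_cell; lia.
Qed.

Lemma clock_left n p : act (clock_cell n p.+1, Left) (clock_tape n p.+1) = clock_tape n p.
Proof.
rewrite /act /clock_tape /=; congr pair; apply/funext => -[|i] //=.
- by rewrite /stail ltnS; case: p => // p; rewrite subn1.
- by rewrite /stail ltnS; case: ltnP => // _; congr clock_cell; lia.
- by rewrite subn0 addn0.
- by case: i => [|i] /=; rewrite /stail; congr clock_cell; lia.
Qed.

Lemma sread_clock n p : sread (clock_tape n p) = clock_cell n p.
Proof. by rewrite /sread /= addn0. Qed.

Lemma clock_stop n b a : a <= n.+1 ->
  (clock_cell n (clock_pos n b a) == dend b) = (a == 0).
Proof.
rewrite /clock_cell /clock_pos; case: b => ha.
  by case: a ha => [|a] ha //=; case: ifP.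
case: a ha => [|a] ha; first by rewrite subn0 /= eqxx.
rewrite /=; case: ifP => [//|h1]; case: ifP => // /eqP; lia.
Qed.

(** [V] is the number of ticks left. The base is [n.+2] because a distance ranges from 0 to
    [n.+1]. *)
Definition clock (n : nat) (d : dirs) (C : 'I_k -> stape S) (V : nat) : Prop :=
  exists a : nat -> nat, [/\ forall i, a i <= n.+1,
    forall i : 'I_k, C i = clock_tape n (clock_pos n (d i) (a i)) &
    V = digits_value n.+2 k a].

Definition stopped (d : dirs) (C : 'I_k -> stape S) (i : 'I_k) : bool :=
  sread (C i) == dend (d i).
Definition carried (d : dirs) (C : 'I_k -> stape S) (i : 'I_k) : bool :=
  [forall j : 'I_k, (j < i) ==> stopped d C j].

Lemma clock_zero n d C : clock n d C 0 -> [forall i, stopped d C i].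
Proof.
move=> [a [ha hC /esym/eqP hV]]; apply/forallP => i.
rewrite /stopped hC sread_clock clock_stop //.
move: hV; rewrite /digits_value sum_nat_eq0 => /forallP /(_ i) /=.
by rewrite muln_eq0 expn_eq0 /= orbF.
Qed.

Lemma clock_tick n d C V : clock n d C V.+1 ->
  [forall i, stopped d C i] = false /\
  clock n [ffun i => if carried d C i && stopped d C i then ~~ d i else d i]
    (fun i => act (sread (C i), if carried d C i && ~~ stopped d C i
                   then (if d i then Left else Right) else Stay) (C i)) V.
Proof.
move=> [a [ha hC hV]].
have hs i : stopped d C i = (a i == 0) by rewrite /stopped hC sread_clock clock_stop.
pose carry i := all (fun j => a j == 0) (iota 0 i).
have hc i : carried d C i = carry i.
  apply/forallP/allP => h j.
    rewrite mem_iota add0n => /= ji; have jk := ltn_trans ji (ltn_ord i).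
    by have := h (Ordinal jk); rewrite ji /= hs.
  by apply/implyP => ji; rewrite hs; apply: h; rewrite mem_iota.
have hk : carry k = false.
  apply/allP => h; move: hV; rewrite /digits_value big1 // => i _.
  have /eqP -> // : a i == 0 by apply: h; rewrite mem_iota /=.
split.
  apply/forallP => h; move/negP: hk; apply; apply/allP => j; rewrite mem_iota /= => jk.
  by have := h (Ordinal jk); rewrite hs.
exists (fun i => if carry i then (if a i == 0 then n.+1 else (a i).-1) else a i); split.
- by move=> i; have := ha i; case: ifP => // _; case: ifP => //; lia.
- move=> i; rewrite ffunE hc hs hC sread_clock.
  have := ha i; case: (carry i) => /=; last first.
    by move=> _; rewrite -sread_clock act_stay.
  case: eqVneq => [-> _|ne] /=.
    rewrite -[X in act (X, _)]sread_clock act_stay; congr clock_tape.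
    by rewrite /clock_pos; case: (d i); rewrite /= ?subn0 ?subnn.
  rewrite /clock_pos; case: (d i) => h.
    by case: (a i) ne => // c _; exact: clock_left.
  rewrite clock_right; congr clock_tape; lia.
(* Some digit is nonzero, so the decrement does not wrap around. *)
- have := digits_pred n.+1 k a; rewrite /= -/(carry k) hk -hV addn0 addn1.
  by case.
Qed.

Lemma clock_init n : clock n [ffun=> true] (fun=> clock_tape n n.+1) (n.+2 ^ k).-1.
Proof.
exists (fun=> n.+1); split=> // [i|]; first by rewrite ffunE.
by rewrite -digits_max addn1.
Qed.

Definition on_input (X : stape S0) : gtapes g :=
  fun j => if j == ginput g then X else (@blanks _, @blanks _).
Definition dinput (w : word) : gtapes g := on_input (@blanks _, sbits g w).

Lemma on_input_act a X :
  gacts (fun j => if j == ginput g then a else (sread (on_input X j), Stay)) (on_input X)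
    = on_input (act a X).
Proof.
apply/funext => j; rewrite /gacts /on_input; case: eqP => // _.
exact: act_stay.
Qed.

Lemma sread_on_input X : sread (on_input X (ginput g)) = sread X.
Proof. by rewrite /on_input eqxx. Qed.

Definition pushed (i : 'I_8) : dstate :=
  if i == 0 :> nat then DLeft (inord 1) else
  if i == 7 :> nat then DLoop else DRun (gstart g) i.

Lemma push_go i d w H C U :
  go D 2 (dconf (DLeft i) d (dinput w) H C U)
    (dconf (pushed i) d (dinput ((i != 0 :> nat) :: w)) H C U).
Proof.
apply: (@go_trans _ _ _ 1 1 _
  (dconf (DPush i) d (on_input (@blanks _, scons None (sbits g w))) H C U)).
  apply: dgo1; [by []|by []| |exact: act_stay|by move=> j; exact: act_stay|by rewrite cats0].
  by rewrite /dinput on_input_act sread_on_input act_left_keep.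
apply: dgo1; [by []|by []| |exact: act_stay|by move=> j; exact: act_stay|by rewrite cats0].
by rewrite on_input_act.
Qed.

Variables (L : word -> bool) (T : nat -> nat) (D0 : language).
Hypothesis T_homo : {homo T : m n / m <= n}.
Hypothesis decides : forall w, exists2 c, go D0 (T (size w)) (ginit g w) c &
  gmode c.1.1 = Halt (L w).

Definition decided (b : bool) (i : 'I_8) : dstate :=
  if b then DAct i else if i < 6 then DLeft (inord i.+1) else DReject.

(** The call takes [T (size w)] steps and its undoing twice as many, with one step to turn around
    and one to leave. *)
Lemma run_go i d w C U :
  go D (3 * T (size w) + 2)
    (dconf (DRun (gstart g) i) d (dinput w) (hist_tape [::]) C U)
    (dconf (decided (L w) i) d (dinput w) (hist_tape [::]) C U).
Proof.
have [c r hc] := decides w.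
have [hs [r1 r2]] := run_undo r i d C U [::] (L w).
apply: (go_leq (n := T (size w) + (1 + (2 * T (size w) + 1)))); first by lia.
apply: go_trans r1 _; apply: go_trans; last apply: go_trans r2 _.
  apply: dgo1; [by []|by rewrite /= hc|exact: dstay_acts| |by move=> j; exact: act_stay
    |by rewrite cats0].
  by rewrite act_left_keep.
have -> : hist_left [::] = hist_tape [::] by rewrite /hist_left /left_of /hist_tape /= scons_blank.
apply: dgo1; [by []|by []|exact: dstay_acts|exact: act_stay|by move=> j; exact: act_stay
  |by rewrite cats0].
Qed.

Definition tower (i : nat) (w : word) : word := nseq i true ++ false :: w.

(** Two steps push a 1, two more surround the call, and the word is longer by at most six ones and a
    0. *)
Definition trial_time (n : nat) : nat := 3 * T (n + 7) + 4.

Lemma tries_go m j d w C U : 0 < j -> j + m = 6 ->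
  (exists l, [/\ j <= l <= 6, L (tower l w) &
     go D (m.+1 * trial_time (size w))
       (dconf (DLeft (inord j)) d (dinput (tower j.-1 w)) (hist_tape [::]) C U)
       (dconf (DAct (inord l)) d (dinput (tower l w)) (hist_tape [::]) C U)]) \/
  ((forall l, j <= l <= 6 -> ~~ L (tower l w)) /\
     exists w', go D (m.+1 * trial_time (size w))
       (dconf (DLeft (inord j)) d (dinput (tower j.-1 w)) (hist_tape [::]) C U)
       (dconf DReject d (dinput w') (hist_tape [::]) C U)).
Proof.
elim: m j => [|m IH] j j0 hj.
all: have ij : (inord j : 'I_8) = j :> nat by rewrite inordK //; lia.
all: have ej : tower j w = true :: tower j.-1 w by case: (j) j0.
all: have s : go D (trial_time (size w))
  (dconf (DLeft (inord j)) d (dinput (tower j.-1 w)) (hist_tape [::]) C U)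
  (dconf (decided (L (tower j w)) (inord j)) d (dinput (tower j w)) (hist_tape [::]) C U).
1,3: apply: (go_leq (n := 2 + (3 * T (size (tower j w)) + 2)));
  [by rewrite /trial_time; have := @T_homo (size (tower j w)) (size w + 7);
      rewrite size_cat size_nseq /=; lia
  |apply: go_trans (run_go _ _ _ _ _);
   have := push_go (inord j) d (tower j.-1 w) (hist_tape [::]) C U;
   rewrite /pushed ij ej !ifF; [|lia|lia]; rewrite (_ : (j != 0) = true) //; lia].
- rewrite mul1n; case hL: (L (tower j w)).
    by left; exists j; split=> //; [lia|rewrite hL in s].
  right; split; first by move=> l hl; rewrite (_ : l = j) ?hL //; lia.
  exists (tower j w); move: s; rewrite hL /decided ij ifF //; lia.
- case hL: (L (tower j w)).
    left; exists j; split=> //; first by lia.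
    by rewrite hL in s; apply: go_leq s; rewrite mulSn leq_addr.
  have := s; rewrite hL /decided ij ifT; last by lia.
  move=> s'; have [||[l [h1 h2 h3]]|[h [w' h']]] := IH j.+1; [by []|by lia|left|right].
    by exists l; split=> //; [lia|rewrite mulSn; apply: go_trans s' h3].
  split; last by exists w'; rewrite mulSn; apply: go_trans s' h'.
  move=> l hl; have [->|ne] := eqVneq l j; first by rewrite hL.
  by apply: h; move/eqP: ne; lia.
Qed.

Definition dloop d C w U : gconfig driver :=
  dconf DLoop d (dinput w) (hist_tape [::]) C U.

(* A query answered yes against the expectation counts as a restart. *)
Definition seen (e : event) (U : word) : event :=
  if (e == EQuery false) && `[< D U >] then ERestart else e.

(** Apart from the six trials: one step for the tick, two to push the 0, one for the event, and two
    for the seventh 1 of a restart. *)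
Definition loop_time (n : nat) : nat := 6 * trial_time n + 6.

Lemma loop_go n d C V w U : clock n d C V.+1 ->
  ((forall e, e != ERestart -> ~~ L (tower (nat_of_event e) w)) /\
   exists d' C' w', go D (loop_time (size w)) (dloop d C w U)
     (dconf DReject d' (dinput w') (hist_tape [::]) C' U)) \/
  exists e d' C', [/\ e != ERestart, L (tower (nat_of_event e) w), clock n d' C' V &
    if e is EHalt b then
      exists2 c, go D (loop_time (size w)) (dloop d C w U) c & gmode c.1.1 = Halt b
    else go D (loop_time (size w)) (dloop d C w U)
      (dloop d' C' (tower (nat_of_event (seen e U)) w)
         (if e is EWrite b then rcons U b else [::]))].
Proof.
move=> /clock_tick [hstop].
set d' := finfun _; set C' := fun i => _; move=> hV.
have s1 : go D 1 (dloop d C w U) (dconf (DLeft ord0) d' (dinput w) (hist_tape [::]) C' U).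
  apply: dgo1; [by []|by rewrite /= hstop|exact: dstay_acts|exact: act_stay|by []|by rewrite cats0].
have s2 := push_go ord0 d' w (hist_tape [::]) C' U.
have s3 := go_trans s1 s2.
have [[l [hl hL s4]]|[hL [w' s4]]] := @tries_go 5 1 d' w C' U isT erefl; last first.
  left; split.
    by move=> e he; apply: hL; case: e he => [[]|[]|[]|].
  by exists d', C', w'; apply: go_leq (go_trans s3 s4); rewrite /loop_time; lia.
right; exists (event_of_nat l), d', C'.
have hl7 : l < 8 by lia.
have le : nat_of_event (event_of_nat l) = l by case: l hl {hL s4 hl7} => [|[|[|[|[|[|[|l]]]]]]].
have er : event_of_nat l != ERestart by case: l hl {hL s4 hl7 le} => [|[|[|[|[|[|[|l]]]]]]].
split=> //; first by rewrite le.
have s5 := go_trans s3 s4; rewrite /seen.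
have hm : dmode (DAct (inord l), d') = match event_of_nat l with
    | EHalt b => Halt b
    | EQuery b => Query (if b then DLoop else DLeft (inord 7), d') (DLoop, d')
    | _ => Work end by rewrite /dmode /= inordK.
case el: (event_of_nat l) er hm le => [b|b|b|] // _ hm le.
- rewrite (_ : EWrite b == EQuery false = false) // le.
  apply: (go_leq (n := 1 + 2 + 6 * trial_time (size w) + 1)).
    by rewrite /loop_time; lia.
  apply: go_trans s5 _; apply: dgo1; [by []|by rewrite /= inordK // el|exact: dstay_acts
    |exact: act_stay|by move=> i; exact: act_stay|by rewrite el -cats1].
- have s6 := @go_query _ driver D _ (dtapes (dinput (tower l w)) (hist_tape [::]) C') U _ _ hm.
  have s7 := go_trans s5 s6.
  case hD: (`[< D U >]) s7 => s7; last first.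
    rewrite andbF; rewrite le; apply: go_leq s7; rewrite /loop_time; lia.
  case: b el hm le s6 s7 => el hm le s6 s7.
    rewrite (_ : EQuery true == EQuery false = false) // le.
    by apply: go_leq s7; rewrite /loop_time; lia.
  have l6 : l = 6 by rewrite -le.
  have s8 := push_go (inord 7) d' (tower l w) (hist_tape [::]) C' [::].
  have e7 : (inord 7 : 'I_8) = 7 :> nat by rewrite inordK.
  rewrite /pushed e7 /= l6 in s8 s7.
  rewrite eqxx /= -/(tower 7 w); apply: go_leq (go_trans s7 s8); rewrite /loop_time; lia.
- exists (dconf (DAct (inord l)) d' (dinput (tower l w)) (hist_tape [::]) C' U) => //.
  apply: go_leq s5; rewrite /loop_time; lia.
Qed.

(** * Setting up the clock, and the running time of the driver *)

Definition scan_tape (p : nat) : stape S :=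
  (fun i => if i.+1 == p then dend true else None, bl).

Lemma scan_tape_right p : act (None, Right) (scan_tape p.+1) = scan_tape p.+2.
Proof. by rewrite /act /scan_tape /=; congr pair; apply/funext => -[|i]. Qed.

Lemma forward_go d y x U :
  go D (size x)
    (dconf DScan d (on_input (sbits g y, sbits g x)) (hist_tape [::])
       (fun=> scan_tape (size y).+1) U)
    (dconf DScan d (on_input (sbits g (rev x ++ y), sbits g [::])) (hist_tape [::])
       (fun=> scan_tape (size (rev x ++ y)).+1) U).
Proof.
elim: x y => [|b x IH] y; first exact: go0.
rewrite rev_cons cat_rcons -[size (b :: x)]add1n; apply: go_trans (IH (b :: y)).
apply: dgo1; [by []|by rewrite /= sread_on_input|exact: on_input_act|exact: act_stay
  |by move=> i; exact: scan_tape_right|by rewrite cats0].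
Qed.

(** The 0 written in front of the input turns it into the code of the empty transcript. *)
Lemma backward_go d y x H C U :
  go D (size y).+1
    (dconf DBack d (on_input (left_of (sbits g y) (sbits g x))) H C U)
    (dconf DLoop d (dinput (false :: rev y ++ x)) H C U).
Proof.
elim: y x => [|b y IH] x.
  apply: dgo1; [by []|by rewrite /= sread_on_input| |exact: act_stay|by move=> i; exact: act_stay
    |by rewrite cats0].
  exact: on_input_act.
rewrite rev_cons cat_rcons -[(size (b :: y)).+1]add1n; apply: go_trans (IH (b :: x)).
apply: dgo1; [by []|by rewrite /= sread_on_input| |exact: act_stay
  |by move=> i; exact: act_stay|by rewrite cats0].
exact: on_input_act.
Qed.

Lemma ginit_driver x :
  ginit driver x = dconf DStart [ffun=> true] (dinput x) (hist_tape [::]) (fun=> (bl, bl)) [::].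
Proof.
congr (_, _, _); apply/funext => -[[j|i]|] //=.
rewrite (inj_eq (@Some_inj _)) (inj_eq (@inl_inj _ _)) /dinput /on_input.
case: ifP => _ //; congr pair; apply/funext => m /=; rewrite /sbits /comp.
by elim: x m => [|b x IH] [|m] //=.
Qed.

Lemma setup_go x :
  go D (2 * size x + 3) (ginit driver x)
    (dloop [ffun=> true] (fun=> clock_tape (size x) (size x).+1) (false :: x) [::]).
Proof.
rewrite ginit_driver.
apply: (go_leq (n := 1 + (size x + (1 + (size (rev x)).+1)))); first by rewrite size_rev; lia.
apply: (@go_trans _ _ _ _ _ _ (dconf DScan [ffun=> true] (on_input (sbits g [::], sbits g x))
  (hist_tape [::]) (fun=> scan_tape 1) [::])).
  apply: dgo1; [by []|by []|exact: dstay_acts|exact: act_stay| |by []].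
  by move=> i; rewrite /act /scan_tape /=; congr pair; apply/funext => -[].
apply: go_trans (forward_go _ _ _ _) _; rewrite cats0.
have := backward_go [ffun=> true] (rev x) [::] (hist_tape [::])
  (fun=> clock_tape (size x) (size x).+1) [::].
rewrite revK cats0 => h; apply: go_trans h.
apply: dgo1; [by []|by rewrite /= sread_on_input| |exact: act_stay| |by []].
  by rewrite on_input_act /act /left_of /= scons_blank.
move=> i; rewrite /act /scan_tape /clock_tape size_rev /=; congr pair.
  apply/funext => m /=; rewrite eqSS; case: (ltngtP m (size x)) => h.
  - have h1 : m < (size x).+1 by rewrite ltnS ltnW.
    have h2 : (size x - m == 0) = false by apply/eqP; lia.
    have h3 : (size x - m == (size x).+1) = false by apply/eqP; lia.
    by rewrite h1 /clock_cell h2 h3.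
  - by rewrite ifF //; lia.
  - by rewrite h ltnSn subnn.
apply/funext => -[|m] /=; rewrite /clock_cell ?addn0 ?eqxx //.
by rewrite ifF //; apply/eqP; lia.
Qed.

Lemma loop_time_homo : {homo loop_time : m n / m <= n}.
Proof.
move=> m n h; rewrite /loop_time /trial_time leq_add2r leq_mul2l leq_add2r leq_mul2l.
by rewrite T_homo ?leq_add2r.
Qed.

Lemma gbound_dreject m d t H C U : gbound D m (dconf DReject d t H C U).
Proof. exact: (@gbound_halt _ driver D m (dconf DReject d t H C U) false). Qed.

(** Whatever the oracle answers, a round that does not halt lowers the clock and lengthens the word
    by at most eight letters, up to seven ones and a 0. *)
Lemma loop_bound n V d C w U : clock n d C V ->
  gbound D (V.+1 * loop_time (size w + 8 * V.+1)) (dloop d C w U).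
Proof.
elim: V d C w U => [|V IH] d C w U hV.
  have s1 : go D 1 (dloop d C w U) (dconf DReject d (dinput w) (hist_tape [::]) C U).
    apply: dgo1; [by []|by rewrite /= (clock_zero hV)|exact: dstay_acts|exact: act_stay
      |by move=> i; exact: act_stay|by rewrite cats0].
  apply: gbound_leq (go_bound s1 (gbound_dreject 0 _ _ _ _ _)).
  by rewrite mul1n /loop_time addn0 addnS.
rewrite mulSn; have h0 : loop_time (size w) <= loop_time (size w + 8 * V.+2).
  by apply: loop_time_homo; rewrite leq_addr.
have [[_ [d' [C' [w' s]]]]|[e [d' [C' [_ _ hV' h]]]]] := loop_go w U hV.
  by apply: gbound_leq (go_bound s (gbound_dreject 0 _ _ _ _ _)); rewrite addn0; lia.
have hb e' U' : gbound D (V.+1 * loop_time (size w + 8 * V.+2))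
    (dloop d' C' (tower (nat_of_event e') w) U').
  apply: gbound_leq (IH _ _ _ _ hV'); rewrite leq_mul2l /=; apply: loop_time_homo.
  rewrite size_cat size_nseq /=.
  have : nat_of_event e' <= 7 by case: (e') => [[]|[]|[]|].
  lia.
case: e h => [b|b|b|] h.
1,2,4: by apply: gbound_leq (go_bound h (hb _ _)); rewrite leq_add2r.
have [c s hc] := h.
apply: gbound_leq (go_bound s (gbound_halt D 0 hc)); rewrite addn0; lia.
Qed.

(** The clock starts at [(n.+2 ^ k).-1], and the first transcript has [n.+1] letters. *)
Definition driver_time (n : nat) : nat :=
  2 * n + 3 + n.+2 ^ k * loop_time (n.+1 + 8 * n.+2 ^ k).

Lemma driver_bound x : gbound D (driver_time (size x)) (ginit driver x).
Proof.
have := loop_bound (false :: x) [::] (clock_init (size x)).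
by rewrite prednK ?expn_gt0 // => /(go_bound (setup_go x)).
Qed.

End Driver.

(** * Logs of productive paths *)

Definition is_halt (e : event) : bool := if e is EHalt _ then true else false.

(** The oracle tape after the events [v], when it held [u] before. *)
Fixpoint pending (u : word) (v : seq event) : word :=
  match v with
  | [::] => u
  | EWrite b :: v' => pending (rcons u b) v'
  | _ :: v' => pending [::] v'
  end.

Fixpoint consistent (B : language) (u : word) (v : seq event) : Prop :=
  match v with
  | [::] => True
  | EWrite b :: v' => consistent B (rcons u b) v'
  | EQuery a :: v' => (B u <-> a) /\ consistent B [::] v'
  | _ :: v' => consistent B [::] v'
  end.

Lemma pending_rcons u v e :
  pending u (rcons v e) = if e is EWrite b then rcons (pending u v) b else [::].
Proof. by elim: v u => [|[b|b|b|] v IH] u /=; rewrite ?IH //; case: e. Qed.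

Lemma consistent_rcons B u v e : consistent B u v ->
  (if e is EQuery a then B (pending u v) <-> a else True) -> consistent B u (rcons v e).
Proof.
elim: v u => [|[b|b|b|] v IH] u /=; first by case: e => [?|?|?|].
- exact: IH.
- by case=> ? /IH h /h.
- exact: IH.
- exact: IH.
Qed.

Lemma pending_size u v : size (pending u v) <= size u + size v.
Proof.
elim: v u => [|[b|b|b|] v IH] u /=; first by rewrite addn0.
- by rewrite (leq_trans (IH _)) // size_rcons addSnnS.
all: by rewrite (leq_trans (IH _)) //=; lia.
Qed.

Section Matches.
Variables (g : gmachine outcome) (D : language).
Implicit Types c : gconfig g.

Lemma gout_matches c o : gout D c o -> verdict o -> matches D c [::].
Proof.
elim=> [c' o' h|c' d o' s _ IH] hv.
  by case ev: (verdict o') hv => [b|] // _; apply: matches_halt h ev _.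
case: c' s => [[q t] u] /=; case hq: (gmode q) => [//|qy qn|].
  by move=> ed; apply: matches_query hq _ _; [exact: erefl|rewrite -ed; exact: IH].
move=> [a ha ed]; apply: (@matches_work _ _ _ _ _ _ _ [::] hq ha).
  by case: (a.1.2).
by rewrite -ed; exact: IH.
Qed.

(** A matching path ends productively, and [v] contains no outcome; so the path has an event beyond
    [v], at the latest its own outcome. *)
Lemma matches_extend c v : matches D c v -> ~~ has is_halt v ->
  exists2 e, e != ERestart & matches D c (rcons v e).
Proof.
elim=> {c v} [c v o b h ho hv|q t u v a v' hq ha hv m IH
  |q t u v v' qy qn hq hv m IH] hh.
- case: v hv hh => [|e v] /=.
    by move=> _ _; exists (EHalt b) => //; apply: matches_halt h ho _; rewrite /= eqxx.
  by case: eqP => // ->.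
- case: a ha hv m IH => [[q' [b|]] f] /= ha hv m IH.
    case: v hv hh => [|e0 v] /=.
      case=> ev; rewrite -ev in m => _; exists (EWrite b) => //.
      by apply: matches_work hq ha _ m; rewrite /= eqxx.
    case: eqP => // e0b [ev] /norP[_ hh]; rewrite -ev in IH.
    have [e he m'] := IH hh; exists e => //.
    by apply: matches_work hq ha _ m'; rewrite /= e0b eqxx.
  case: hv => ev; rewrite ev in hh *; have [e he m'] := IH hh; exists e => //.
  by apply: matches_work hq ha _ m'.
- case: v hv hh => [|e0 v] /=.
    case=> ev; rewrite -ev in m => _; exists (EQuery `[< D u >]) => //.
    by apply: matches_query hq _ m; rewrite /= eqxx.
  case: eqP => // e0b [ev] /norP[_ hh]; rewrite -ev in IH.
  have [e he m'] := IH hh; exists e => //.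
  by apply: matches_query hq _ m'; rewrite /= e0b eqxx.
Qed.

(** Each event of [v] is a write or an answer, so it uses up a step of the matching path. *)
Lemma matches_size m c v : gbound D m c -> matches D c v -> ~~ has is_halt v ->
  size v <= m.
Proof.
move=> hb hm; elim: hm m hb => {c v} [c v o b h ho hv|q t u v a v' hq ha hv hm IH
  |q t u v v' qy qn hq hv hm IH] m hb hh.
- by case: v hv hh => [|e v] //=; case: eqP => // ->.
- have hs : gstep D (q, t, u) (a.1.1, gacts a.2 t, u ++ wbit a.1.2).
    by rewrite /= hq; exists a.
  case: m hb => [|m] hb; first by case: (hb _ hs).
  have {}IH := IH m (hb _ hs).
  case: (a.1.2) hv => [b|]; last by case=> ev; rewrite -ev in IH; apply/leqW/IH.
  case: v hh => [|e0 v] //= /norP[_ hh]; case: eqP => // _ [ev].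
  by rewrite ltnS ev; apply: IH; rewrite -ev.
- have hs : gstep D (q, t, u) (if `[< D u >] then qy else qn, t, [::]) by rewrite /= hq.
  case: m hb => [|m] hb; first by case: (hb _ hs).
  have {}IH := IH m (hb _ hs).
  case: v hv hh => [|e0 v] //=; case: eqP => // _ [ev] /norP[_ hh].
  by rewrite ltnS ev; apply: IH; rewrite -ev.
Qed.

(** The path itself may depend on choices, but the word of its next query is determined by the bits
    in the log. *)
Lemma matches_query_last c v a : matches D c (rcons v (EQuery a)) -> ~~ has is_halt v ->
  D (pending c.2 v) <-> a.
Proof.
move ew: (rcons v (EQuery a)) => w hm.
elim: hm v ew => {c w} [c w o b h ho hv|q t u w a' w' hq ha hv hm IH
  |q t u w w' qy qn hq hv hm IH] v ew hh.
- move: hv; rewrite -ew; case: v hh {ew} => [|e v] //=; case: eqP => // ->; by [].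
- case: a' ha hv hm IH => [[q' [b|]] f] /= ha hv hm IH; last first.
    by case: hv => hv; rewrite cats0 in IH; apply: IH hh; rewrite ew.
  move: hv; rewrite -ew; case: v ew hh => [|e v] ew //= /norP[_ hh].
  case: eqP => // -> [ev]; rewrite cats1 in IH; exact: IH ev hh.
- move: hv; rewrite -ew; case: v ew hh => [|e v] ew //=.
    move=> _; case: eqP => // -[->] _; split; first by move/asboolT.
    by move/asboolP.
  move=> /norP[_ hh]; case: eqP => // -> [ev]; exact: IH ev hh.
Qed.

(** All answers met before the outcome are in [v] and agree with [B], so the same choices give a
    path with oracle [B]. *)
Lemma matches_halt_last B c v b : matches D c (rcons v (EHalt b)) -> ~~ has is_halt v ->
  consistent B c.2 v -> exists2 o, gout B c o & verdict o = Some b.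
Proof.
move ew: (rcons v (EHalt b)) => w hm.
elim: hm v ew => {c w} [c w o b' h ho hv|q t u w a' w' hq ha hv hm IH
  |q t u w w' qy qn hq hv hm IH] v ew hh hc.
- exists o; first exact: gout_halt.
  move: hv; rewrite -ew ho; case: v hh {ew hc} => [|e v] /=.
    by case: eqP => // -[->].
  by move=> /norP[he _]; case: eqP => // e'; rewrite e' in he.
- have [o r ho] : exists2 o, gout B (a'.1.1, gacts a'.2 t, u ++ wbit a'.1.2) o &
      verdict o = Some b.
    case: a' ha hv hm IH => [[q' [b'|]] f] /= ha hv hm IH; last first.
      by case: hv => hv; apply: IH hh _ => //; [rewrite ew|rewrite cats0].
    move: hv; rewrite -ew; case: v ew hh hc => [|e v] ew //= /norP[_ hh].
    case: eqP => // -> hc [ev]; apply: IH ev hh _; by rewrite cats1.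
  exists o => //; apply: gout_step r; rewrite /= hq; by exists a'.
- move: hv; rewrite -ew; case: v ew hh hc => [|e v] ew //= /norP[_ hh].
  case: eqP => // -> [hB hc] [ev].
  have [o r ho] := IH v ev hh hc.
  exists o => //; apply: gout_step r; rewrite /= hq.
  have -> // : `[< B u >] = `[< D u >].
  by apply/asboolP/idP => /hB.
Qed.

End Matches.

(** * Polynomial bounds and correctness *)

(** The base is at least 2, so constants and sums are absorbed by a larger exponent. *)
Definition poly_bounded (f : nat -> nat) : Prop := exists k, forall n, f n <= (n + 2) ^ k.

Lemma exp2n_gt0 n k : 0 < (n + 2) ^ k.
Proof. by rewrite expn_gt0 addn2. Qed.

Lemma leq_expr m n k : m <= n -> m ^ k <= n ^ k.
Proof. by case: k => // k h; rewrite leq_exp2r. Qed.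

Lemma poly_bounded_leq f f' : (forall n, f n <= f' n) -> poly_bounded f' -> poly_bounded f.
Proof. by move=> h [k hk]; exists k => n; apply: leq_trans (h n) (hk n). Qed.

Lemma poly_boundedM f f' : poly_bounded f -> poly_bounded f' ->
  poly_bounded (fun n => f n * f' n).
Proof. by move=> [k hk] [k' hk']; exists (k + k') => n; rewrite expnD leq_mul. Qed.

Lemma poly_boundedD f f' : poly_bounded f -> poly_bounded f' ->
  poly_bounded (fun n => f n + f' n).
Proof.
(* For positive [c] and [d] the sum is at most [2 * (c * d)]; the additional factor [n + 2] pays for
   the 2. *)
move=> [k hk] [k' hk']; exists (k + k').+1 => n; rewrite expnS expnD.
move: (hk n) (hk' n) (exp2n_gt0 n k) (exp2n_gt0 n k').
move: (f n) (f' n) ((n + 2) ^ k) ((n + 2) ^ k') => a b c d; nia.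
Qed.

Lemma poly_bounded_id : poly_bounded id.
Proof. by exists 1 => n; rewrite expn1 leq_addr. Qed.

Lemma poly_bounded_cst c : poly_bounded (fun=> c).
Proof.
exists c => n; apply: leq_trans (ltnW (ltn_expl c (isT : 1 < 2))) _.
exact: leq_expr (leq_addl _ _).
Qed.

Lemma poly_boundedS f : poly_bounded f -> poly_bounded (fun n => (f n).+1).
Proof.
move=> hf; apply: poly_bounded_leq (poly_boundedD hf (poly_bounded_cst 1)) => n.
by rewrite addn1.
Qed.

Lemma poly_bounded_comp f f' : poly_bounded f -> poly_bounded f' ->
  poly_bounded (fun n => f (f' n)).
Proof.
move=> [k hk] hf'; have [k' hk'] := poly_boundedD hf' (poly_bounded_cst 2).
by exists (k' * k) => n; apply: leq_trans (hk _) _; rewrite expnM; apply: leq_expr.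
Qed.

Lemma poly_boundedX k f : poly_bounded f -> poly_bounded (fun n => f n ^ k).
Proof.
move=> hf; elim: k => [|k IH]; first exact: poly_bounded_cst.
by apply: poly_bounded_leq (poly_boundedM hf IH) => n; rewrite expnS.
Qed.

Lemma poly_bounded_horner (p : {poly nat}) : poly_bounded (fun n => p.[n]%R).
Proof.
rewrite /horner; elim: (polyseq p) => [|c s IH]; first exact: poly_bounded_cst.
exact: poly_boundedD (poly_boundedM IH poly_bounded_id) (poly_bounded_cst c).
Qed.

Lemma poly_bounded_poly f : poly_bounded f -> exists p : {poly nat}, forall n, f n <= p.[n]%R.
Proof.
move=> [k hk]; exists (('X + 2%:P) ^+ k)%R => n.
apply: leq_trans (hk n) _.
rewrite horner_exp hornerD hornerX hornerC.
have -> // : ((n + 2)%R ^+ k)%R = (n + 2) ^ k.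
by elim: k {hk} => // k IH; rewrite expnS -IH GRing.exprS.
Qed.

(** * Runs of deterministic machines *)

Section Deterministic.
Variables (O : Type) (g : gmachine O).
Hypothesis one_action : forall (q : gstate g) s, exists a, gdelta q s = [set a].

Lemma go_halt D m (c : gconfig g) : gbound D m c ->
  exists2 c', go D m c c' & exists o, gmode c'.1.1 = Halt o.
Proof.
have next_unique (c1 : gconfig g) : (forall o, gmode c1.1.1 <> Halt o) ->
    exists d, forall d', gstep D c1 d' <-> d' = d.
  case: c1 => [[q t] u] /= hh; case hq: (gmode q) => [o|qy qn|].
  - by case: (hh o).
  - by exists (if `[< D u >] then qy else qn, t, [::]).
  - have [a ha] := one_action q (fun i => sread (t i)).
    exists (a.1.1, gacts a.2 t, u ++ wbit a.1.2) => d'; rewrite ha.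
    by split=> [[_ -> ->]|->] //; exists a.
elim: m c => [|m IH] c hb; have [[o hq]|hh] := pselect (exists o, gmode c.1.1 = Halt o).
1,3: by exists c; [exact: go0|exists o].
all: have [|d hd] := next_unique c; first by move=> o ho; apply: hh; exists o.
  by case: (hb _ ((hd _).2 erefl)).
have [c' r hc'] := IH _ (hb _ ((hd _).2 erefl)).
by exists c' => //; apply: goS hd r.
Qed.

Lemma gout_unique D m (c : gconfig g) o o' : gbound D m c -> gout D c o -> gout D c o' -> o = o'.
Proof.
move=> /go_halt[c' r [o1 ho]].
by rewrite !(go_out _ r) !(gout_haltE _ _ ho) => -> ->.
Qed.

End Deterministic.

(** There is always an action at a working state, so a path of bounded length can only end by
    halting. *)
Lemma gbound_out O (g : gmachine O) D m (c : gconfig g) : gbound D m c ->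
  exists o, gout D c o.
Proof.
elim: m c => [|m IH] [[q t] u] hb; case hq: (gmode q) => [o|qy qn|].
all: try by exists o; exact: gout_halt.
all: have [d hd] : exists d, gstep D (q, t, u) d.
all: try by rewrite /= hq; eexists.
all: try by rewrite /= hq; have [a ha] := gdelta_neq0 (g := g) q (fun i => sread (t i));
  eexists; exists a.
all: try by case: (hb _ hd).
all: by have [o ho] := IH _ (hb _ hd); exists o; apply: gout_step hd ho.
Qed.

(** * Correctness of the driver with oracle [B] *)

Section Correctness.
Variables (g : gmachine outcome) (h : gmachine bool) (k : nat).
Variable next : gstate h -> (gtape h -> symbol (gletter h)) ->
  gstate h * option bool * (gtape h -> symbol (gletter h) * move).
Hypothesis nextP : forall q s, gdelta q s = [set next q s].
Hypothesis no_query : forall q qy qn : gstate h, gmode q <> Query qy qn.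
Variables (L : word -> bool) (T : nat -> nat) (D0 : language).
Hypothesis T_homo : {homo T : m n / m <= n}.
Hypothesis decides : forall w, exists2 c, go D0 (T (size w)) (ginit h w) c &
  gmode c.1.1 = Halt (L w).

Variables (B : language) (x : word) (P R : nat) (A : Prop).
Hypothesis LP : forall s,
  L (code s x) <-> matches (lookup (flat (items s))) (ginit g x) (log s).
Hypothesis g_bound : forall D, gbound D P (ginit g x).
Hypothesis productive : forall D, matches D (ginit g x) [::].
Hypothesis sound : forall o b, gout B (ginit g x) o -> verdict o = Some b -> b <-> A.
Hypothesis B_sparse : forall ws : seq word, uniq ws ->
  (forall w, w \in ws -> B w /\ size w <= P) -> size ws <= R.

(** The invariant of the loop: Y consists of distinct short words of [B], some productive path with
    oracle Y matches the log, and the answers in the log are also those of [B]. *)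
Record valid (s : seq event) (U : word) : Prop := Valid {
  valid_halt : ~~ has is_halt (log s);
  valid_items : forall z, z \in items s -> B (rev z) /\ size z <= P;
  valid_uniq : uniq (items s);
  valid_word : U = rev (last_query s);
  valid_matches : matches (lookup (flat (items s))) (ginit g x) (log s);
  valid_consistent : consistent B [::] (log s)
}.

(** A restart discards a log of at most [P] events and gains an item, which therefore weighs [P.+1]:
    each round that does not halt increases this number. *)
Definition progress (s : seq event) : nat := size (items s) * P.+1 + size (log s).

Lemma pending_log s : pending [::] (log s) = rev (last_query s).
Proof.
by elim: s => [|[b|b|b|] s IH] //=; rewrite pending_rcons ?IH ?rev_cons.
Qed.

Lemma valid_log_size s U : valid s U -> size (log s) <= P.
Proof. by move=> v; apply: matches_size (g_bound _) (valid_matches v) (valid_halt v). Qed.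

Lemma valid_progress s U : valid s U -> progress s <= R * P.+1 + P.
Proof.
move=> v; rewrite /progress leq_add ?(valid_log_size v) // leq_mul2r /=.
rewrite -(size_map rev); apply: B_sparse.
  by rewrite (map_inj_uniq (can_inj revK)) (valid_uniq v).
by move=> _ /mapP[z /(valid_items v) [hB hz] ->]; rewrite size_rev.
Qed.

Lemma loop_correct n V d (C : 'I_k -> stape (symbol (dletter h))) s U :
  clock n d C V -> valid s U -> R * P.+1 + P < V + progress s ->
  exists m (b : bool), (b <-> A) /\
    exists2 c, go B m (dloop next d C (code s x) U) c & gmode c.1.1 = Halt b.
Proof.
elim: V d C s U => [|V IH] d C s U hV v hP.
  (* With the clock at zero, the progress would exceed its maximum. *)
  by have := valid_progress v; rewrite leqNgt hP.
have [[hL _]|[e [d' [C' [he hL hV' hgo]]]]] :=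
    loop_go B nextP no_query T_homo decides (code s x) U hV.
  (* The trials cannot all fail, since the log of a productive path has an extension. *)
  have [e he me] := matches_extend (valid_matches v) (valid_halt v).
  have /negP[] := hL e he; rewrite -[tower _ _]/(code (e :: s) x).
  by apply/LP; case: e he me {hL}.
have me : matches (lookup (flat (items s))) (ginit g x) (rcons (log s) e).
  by move: hL; rewrite -[tower _ _]/(code (e :: s) x) => /LP; case: e he {hgo}.
have pU : pending [::] (log s) = U by rewrite pending_log (valid_word v).
have sz := valid_log_size v.
have cont s' U' : valid s' U' -> progress s < progress s' ->
    go B (loop_time T (size (code s x))) (dloop next d C (code s x) U)
      (dloop next d' C' (code s' x) U') ->
    exists m (b : bool), (b <-> A) /\
      exists2 c, go B m (dloop next d C (code s x) U) c & gmode c.1.1 = Halt b.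
  move=> v' hp r; have [|m [b [hb [c r' hc]]]] := IH d' C' s' U' hV' v'; first by lia.
  exists (loop_time T (size (code s x)) + m), b; split=> //; exists c => //.
  exact: go_trans r r'.
case: e he hL me hgo => [b|b|b|] // _ hL me hgo.
- apply: (cont (EWrite b :: s) (rcons U b)); last exact: hgo.
    split=> /=; rewrite ?has_rcons ?(valid_halt v) //.
    + exact: (valid_items v).
    + exact: valid_uniq v.
    + by rewrite rev_cons (valid_word v).
    + exact: consistent_rcons (valid_consistent v) _.
  by rewrite /progress /= size_rcons addnS.
- have hq := matches_query_last me (valid_halt v); rewrite /= pU in hq.
  have hl : lookup (flat (items s)) U <-> last_query s \in items s.
    by rewrite lookup_flat (valid_word v) revK.
  have [hs|hs] := boolP ((EQuery b == EQuery false) && `[< B U >]).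
    apply: (cont (ERestart :: s) [::]).
    + case/andP: hs => /eqP[bf] /asboolP BU; rewrite bf in hq.
      split=> //=.
      * move=> z; rewrite inE => /orP[/eqP->|]; last exact: (valid_items v).
        rewrite -(valid_word v); split=> //.
        by rewrite -size_rev -(valid_word v) -pU (leq_trans (pending_size _ _)).
      (* Y answered no to this word, so it is new. *)
      * rewrite (valid_uniq v) andbT; apply/negP => /hl /hq //.
    + rewrite /progress /= mulSn; lia.
    + by move: hgo; rewrite /seen hs.
  apply: (cont (EQuery b :: s) [::]).
  + split=> /=; rewrite ?has_rcons ?(valid_halt v) //.
    * exact: (valid_items v).
    * exact: valid_uniq v.
    * apply: consistent_rcons (valid_consistent v) _; rewrite pU.
      (* An expected yes comes from Y, which is contained in [B]; an expected no that [B] refutes is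
         the restart excluded by [hs]. *)
      case: b hq hs {hL me hgo} => hq hs; split=> // hB.
        have /hl /(valid_items v) [] := hq.2 isT.
        by rewrite -(valid_word v).
      by move: hs; rewrite eqxx asboolT.
  + by rewrite /progress /= size_rcons addnS.
  + by move: hgo; rewrite /seen (negPf hs).
- have [c r hc] := hgo.
  have [o ro ho] := matches_halt_last me (valid_halt v) (valid_consistent v).
  exists (loop_time T (size (code s x))), b; split; first exact: sound ro ho.
  by exists c.
Qed.

(** The progress starts at 0 and the clock one below the power, hence the summand 1. *)
Lemma driver_correct : R * P.+1 + P + 1 < (size x).+2 ^ k ->
  gout B (ginit (driver k next) x) true <-> A.
Proof.
move=> hk.
have v0 : valid [::] [::] by split=> //; exact: productive.
have [|m [b [hb [c r hc]]]] := loop_correct (clock_init h k (size x)) v0.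
  by rewrite /progress /= addn0; lia.
have r' := go_trans (setup_go k next B x) r.
by rewrite (go_out _ r') (gout_haltE _ _ hc) -hb; split=> [<-|->].
Qed.

End Correctness.

Lemma gmachine_of_one_action O (M : machine O) : deterministic M ->
  forall (q : state M) s, exists a, odelta q s = [set a].
Proof.
move=> hM q s; have /eqP/cards1P[[[q' b] f] hd] := hM q [ffun i => s i].
exists (q', b, f : _ -> _); apply/seteqP; split=> [[[q1 b1] f1]|_ ->]; rewrite /odelta /= hd inE.
  move=> /eqP[-> -> hf]; congr (_, _, _); apply/funext => i.
  by rewrite -hf ffunE.
by apply/eqP; congr (_, _, _); apply/ffunP => i; rewrite ffunE.
Qed.

Lemma polytime_bound O (M : machine O) : polytime M -> exists k, forall D x,
  gbound D ((size x + 2) ^ k) (ginit (gmachine_of M) x).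
Proof.
move=> [p hp]; have [k hk] := poly_bounded_horner p; exists k => D x.
by apply: gmachine_of_bound => n c /hp hn; apply: leq_trans hn (hk _).
Qed.

Lemma compile_polytime O (g : gmachine O) f : poly_bounded f ->
  (forall D x, gbound D (f (size x)) (ginit g x)) -> polytime (compile g).
Proof.
move=> /poly_bounded_poly[p hp] hg; exists p => D x n c r.
exact: leq_trans (compile_bound (hg D x) r) (hp _).
Qed.

(** * Deterministic reductions are O-reductions *)

Section ReducesTO.
Variable M : machine bool.

Definition decisive : machine outcome :=
  @Machine outcome (ntapes M) (state M) (letter M) (start M)
    (fun q => match mode_of q with
              | Halt b => Halt (if b then Acc else Rej)
              | Query qy qn => Query qy qn
              | Work => Work
              end) (@delta _ M) (@delta_gt0 _ M).

Lemma decisive_step D (c c' : config M) : step (M := decisive) D c c' <-> step D c c'.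
Proof.
split.
  case=> [q t w q' b f /= hq hd|q t w qy qn /= hq hD|q t w qy qn /= hq hD];
    case hm: (mode_of (m := M) q) hq => [o|y n|] //.
  - by move=> _; apply: step_work.
  - by case=> <- _; apply: step_yes hm hD.
  - by case=> _ <-; apply: step_no hm hD.
case=> [q t w q' b f hq hd|q t w qy qn hq hD|q t w qy qn hq hD].
- by apply: (step_work (M := decisive)) => //=; rewrite hq.
- by apply: (@step_yes _ decisive _ _ _ _ qy qn) => //=; rewrite hq.
- by apply: (@step_no _ decisive _ _ _ _ qy qn) => //=; rewrite hq.
Qed.

Lemma decisive_run D (c c' : config M) n : run (M := decisive) D c n c' <-> run D c n c'.
Proof.
split; elim=> {n c'} [|n c1 c2 _ IH s]; try exact: run0.
  by apply: runS IH _; apply/decisive_step.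
by apply: (runS (M := decisive)) IH _; apply/decisive_step.
Qed.

Lemma decisive_out D x o :
  out decisive D x o <-> exists2 b, out M D x b & o = if b then Acc else Rej.
Proof.
split=> [[n [c [/decisive_run r]]]|[b [n [c [r hc]]] ->]].
  rewrite /=; case hm: (mode_of _) => [b|qy qn|] // -[<-].
  by exists b => //; exists n, c.
by exists n, c; split; [apply/decisive_run|rewrite /= hc].
Qed.

End ReducesTO.

(** With any oracle some path ends, and it ends in [Acc] or [Rej]; determinism excludes that both
    occur. *)
Lemma reducesT_reducesO (A B : language) : reducesT A B -> reducesO A B.
Proof.
move=> [M [hp hd hA]]; have [k hk] := polytime_bound hp.
have hdet := gmachine_of_one_action hd.
exists (decisive M); split.
- by case: hp => p hp; exists p => D x n c /decisive_run; exact: hp.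
- move=> D x e; have [b /gmachine_of_out hb] := gbound_out (hk D x).
  have : out (decisive M) D x (if b then Acc else Rej) by apply/decisive_out; exists b.
  by rewrite e; case: (b).
- move=> x h.
  have /decisive_out[[] h1 //] := h Acc (or_introl erefl).
  have /decisive_out[[] h2 //] := h Rej (or_intror erefl).
  move/gmachine_of_out: h1; move/gmachine_of_out: h2 => h2 h1.
  by have := @gout_unique _ (gmachine_of M) hdet _ _ _ _ _ (hk B x) h1 h2.
- rewrite hA; apply/seteqP; split=> x.
    by move=> h; apply/decisive_out; exists true.
  by move=> /decisive_out[[]].
Qed.

(** * O-reductions to sparse sets are deterministic reductions if P = NP *)

Lemma sparse_size (B : language) (r : {poly nat}) :
  (forall n, #|[pred w : n.-bseq bool | `[< B w >]]| <= r.[n]%R) ->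
  forall n (ws : seq word), uniq ws -> (forall w, w \in ws -> B w /\ size w <= n) ->
  size ws <= r.[n]%R.
Proof.
move=> hr n ws hu hw; apply: leq_trans (hr n).
have insK w : size w <= n -> insub_bseq n w = w :> word by move=> h; rewrite [LHS]val_insubd h.
rewrite -(size_map (fun w => insub_bseq n w)) cardE; apply: uniq_leq_size.
  rewrite map_inj_in_uniq // => w w' /hw[_ h] /hw[_ h'] /(congr1 val).
  by rewrite /= !insK.
by move=> _ /mapP[w /hw[hB hs] ->]; rewrite mem_enum inE /= insK.
Qed.

Lemma verifier_time_poly p : poly_bounded p -> poly_bounded (verifier_time p).
Proof.
move=> hp; have hS := poly_boundedS poly_bounded_id.
exact: poly_boundedD hS (poly_boundedM (poly_boundedS hp)
  (poly_boundedM hS (poly_boundedD hp (poly_bounded_cst 5)))).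
Qed.

Lemma driver_time_poly k k0 : poly_bounded (driver_time k (fun n => (n + 2) ^ k0)).
Proof.
have cst := poly_bounded_cst; have id := poly_bounded_id.
have addS c : poly_bounded (fun n => n + c) by exact: poly_boundedD.
have hX : poly_bounded (fun n => n.+2 ^ k).
  apply: poly_boundedX; apply: poly_bounded_leq (addS 2) => n; by rewrite addn2.
have hT : poly_bounded (trial_time (fun n => (n + 2) ^ k0)).
  apply: poly_boundedD (cst 4); apply: poly_boundedM (cst 3) _.
  exact: poly_bounded_comp (poly_boundedX k0 (addS 2)) (addS 7).
have hL : poly_bounded (loop_time (fun n => (n + 2) ^ k0)).
  exact: poly_boundedD (poly_boundedM (cst 6) hT) (cst 6).
apply: poly_boundedD; first exact: poly_boundedD (poly_boundedM (cst 2) id) (cst 3).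
apply: (poly_boundedM hX); apply: (poly_bounded_comp hL).
apply: poly_boundedD; last exact: poly_boundedM (cst 8) hX.
exact: poly_boundedS id.
Qed.

Lemma reducesO_reducesT (A B : language) : classP = classNP -> sparse B ->
  reducesO A B -> reducesT A B.
Proof.
move=> PNP [r hr] [N [hN hover hunder hA]].
have [kN hkN] := polytime_bound hN.
pose g := gmachine_of N; pose p n := (n + 2) ^ kN.
have p_homo : {homo p : m n / m <= n} by move=> m n h; apply: leq_expr; rewrite leq_add2r.
have p_poly : poly_bounded p by exists kN.
pose K := compile (verifier g).
have spec D w := verifier_spec D w p_homo hkN.
(* The hypothesis P = NP is applied to this language, which depends only on N. *)
have : classNP (accepted K set0).
  exists K; split=> //; last by case.
  exact: compile_polytime (verifier_time_poly p_poly) (fun D w => (spec D w).1).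
rewrite -PNP => -[M0 [hM0 hdet hfree hacc]].
have [k0 hk0] := polytime_bound hM0.
pose h := gmachine_of M0; pose T n := (n + 2) ^ k0.
have hone := gmachine_of_one_action hdet.
have [next nextP] : exists next : gstate h -> (gtape h -> symbol (gletter h)) ->
    gstate h * option bool * (gtape h -> symbol (gletter h) * move),
    forall q s, gdelta q s = [set next q s].
  exists (fun q s => projT1 (cid (hone q s))) => q s.
  by case: (cid (hone q s)).
(* [K] and [M0] accept the same language; [L] is its characteristic function, described through the
   verifier and computed by [M0]. *)
pose L (w : word) := `[< gout set0 (ginit (verifier g) w) true >].
have decides w : exists2 c, go set0 (T (size w)) (ginit h w) c & gmode c.1.1 = Halt (L w).
  have [c rc [b hc]] := @go_halt _ h hone _ _ _ (hk0 set0 w).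
  exists c => //; rewrite hc; congr Halt; apply/idP/asboolP => [hb|].
    have : accepted M0 set0 w.
      by apply/gmachine_of_out/(go_out _ rc); rewrite (gout_haltE _ _ hc) hb.
    by rewrite -hacc => /compile_out.
  move=> hb; have : accepted K set0 w by apply/compile_out.
  rewrite hacc => /gmachine_of_out /(go_out _ rc).
  by rewrite (gout_haltE _ _ hc) => <-.
have LP x s : L (code s x) <-> matches (lookup (flat (items s))) (ginit g x) (log s).
  rewrite /L; split=> [/asboolP|hm]; last apply/asboolP.
    by rewrite (spec _ _).2 parse_code /= cats0.
  by rewrite (spec _ _).2 parse_code /= cats0.
have T_homo : {homo T : m n / m <= n} by move=> m n hmn; apply: leq_expr; rewrite leq_add2r.
(* The clock has to outlast the maximal progress; the 2 yields the strict inequality and the summand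
   1 in [driver_correct]. *)
have [k hk] : poly_bounded (fun n => r.[p n]%R * (p n).+1 + p n + 2).
  have hrp := poly_bounded_comp (poly_bounded_horner r) p_poly.
  apply: poly_bounded_leq (poly_boundedD (poly_boundedD (poly_boundedM hrp
    (poly_boundedD p_poly (poly_bounded_cst 1))) p_poly) (poly_bounded_cst 2)) => n.
  by rewrite addn1.
have no_query q qy qn : gmode (g := h) q <> Query qy qn by exact: hfree.
exists (compile (driver k next)); split.
- exact: compile_polytime (driver_time_poly k _) (fun D x =>
    driver_bound k D nextP no_query T_homo decides x).
- by apply: compile_deterministic => q s; eexists.
- suff acc x : gout B (ginit (driver k next) x) true <-> A x.
    by apply/seteqP; split=> x; [move=> /acc hx; apply/compile_out|move=> /compile_out /acc].
  apply: (driver_correct nextP no_query T_homo decides (g := g) (P := p (size x))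
    (R := r.[p (size x)]%R)).
  + exact: LP.
  + by move=> D; exact: hkN.
  (* Without a productive outcome, the set of outcomes, which is nonempty, would be exactly
     [[set Unknown]], against overproductivity with oracle [D]. *)
  + move=> D; have [o ho] := gbound_out (hkN D x).
    have [[o' [ho' /gout_matches h']]|hno] :=
        pselect (exists o', gout D (ginit g x) o' /\ verdict o').
      exact: h'.
    have all_unknown o' : gout D (ginit g x) o' -> o' = Unknown.
      by move=> ho'; case: o' ho' => // ho'; case: hno; eexists; split; try exact: ho'.
    case: (hover D x); apply/seteqP; split=> [o' /gmachine_of_out /all_unknown //|_ ->].
    by apply/gmachine_of_out; rewrite -(all_unknown o).
  (* If [Rej] occurs with oracle [B], then [Acc] does not, by underproductivity. *)
  + move=> o b ho hv; rewrite hA; move: ho => /gmachine_of_out ho.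
    case: o ho hv => // ho [<-]; split=> // hacc'.
    by case: (hunder x) => o [] ->.
  + by move=> ws; apply: sparse_size.
  + by rewrite -(addn2 (size x)); apply: leq_trans (hk _); rewrite -addnS.
Qed.

Theorem theorem4p9 :
  (exists B : language, sparse B /\
     [set A : language | reducesO A B] <> [set A : language | reducesT A B]) ->
  classP <> classNP.
Proof.
move=> [B [hB hneq]] hPNP; apply: hneq; apply/seteqP; split=> A /=.
  exact: reducesO_reducesT.
exact: reducesT_reducesO.
Qed.
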